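(* Let $q$ be a power of a prime $p$ and let $h(x) = x^8 + a_1x^7 + a_2x^6 + a_3x^5 + a_4x^4 + a_3qx^3 + a_2q^2x^2 + a_1q^3x + q^4$ with $a_1,\dots,a_4 \in \mathbb{Z}$. Consider the inequalities: (a) $|a_1| \leq 8\sqrt{q}$; (b* ) $6\sqrt{q}\,|a_1| - 20q \leq a_2$; (b) $a_2 \leq \frac{3}{8}a_1^2 + 4q$; (c) $-9qa_1 - 4\sqrt{q}\,a_2 - 16q\sqrt{q} \leq a_3 \leq -9qa_1 + 4\sqrt{q}\,a_2 + 16q\sqrt{q}$; (d) $\frac12 a_1a_2 - \frac18 a_1^3 + qa_1 - \frac{1}{216}(9a_1^2 - 24a_2 + 96q)^{3/2} \leq a_3 \leq \frac12 a_1a_2 - \frac18 a_1^3 + qa_1 + \frac{1}{216}(9a_1^2 - 24a_2 + 96q)^{3/2}$; (e) $2\sqrt{q}\,|qa_1 + a_3| - 2qa_2 - 2q^2 \leq a_4$; where the quantity $9a_1^2-24a_2+96q$ in (d) is a non-negative real number by (b). Define the real numbers $u_2 = -\frac{3a_1^2}{16} + \frac{a_2}{2} - 2q$, $u_3 = -\frac{a_1^3}{32} + \frac{a_1a_2}{8} + \frac{a_1q}{4} - \frac{a_3}{4}$, $\Delta = u_3^2 + \frac{4u_2^3}{27}$, and the set $S = \left\{ -\zeta^k\omega\left(\frac{9u_3}{2} + \frac{3\sqrt{\Delta}}{2}\right) - \zeta^{-k}\bar\omega\left(\frac{9u_3}{2} - \frac{3\sqrt{\Delta}}{2}\right) + \frac{2u_2^2}{3}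 : 0 \leq k \leq 2\right\}$, where $\zeta$ is a primitive third root of unity, $\sqrt{\Delta}$ is a complex square root of $\Delta$, and $\omega$ is a complex third root of $\frac12(-u_3 + \sqrt{\Delta})$. If $h(x) \in W_q(4)$ or (a)–(d) hold, then $S$ consists of real numbers. Assuming this, sort the elements of $S$ as $\theta_1 \leq \theta_2 \leq \theta_3$ and consider (f) $\frac{3}{256}a_1^4 - \frac{1}{16}a_1^2a_2 - \frac12 qa_1^2 + \frac14 a_1a_3 + 2qa_2 - 2q^2 + \theta_1 \leq a_4 \leq \frac{3}{256}a_1^4 - \frac{1}{16}a_1^2a_2 - \frac12 qa_1^2 + \frac14 a_1a_3 + 2qa_2 - 2q^2 + \theta_2$. Then $h(x) \in W_q(4)$ if and only if (a)–(f) all hold. Moreover, $h(x) \in W_q(4)$ has a real root if and only if at least one of the inequalities in (a), (b* ), (c) or (e) is an equality. Explicitly, $h(x)$ lies in $W_q(4)$ and has a real root if and only if exactly one of the following (mutually exclusive) cases occurs: (I) $q$ is a square and $h(x) = (x+\sqrt{q})^2h_0(x)$ or $h(x) = (x-\sqrt{q})^2h_0(x)$ with $h_0(x) \in W_q(3)$; (II) $q$ is not a square and $h(x) = (x^2-q)^2h_0(x)$ with $h_0(x) \in W_q(2)$.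
   Context: A $q$-Weil polynomial is a monic polynomial in $\mathbb{Z}[x]$ of even positive degree $2g$ whose set of complex roots has the form $\{w_1,\bar w_1,\ldots,w_g,\bar w_g\}$ with $|w_i| = \sqrt{q}$ for every $i$. $W_q(g)$ denotes the set of $q$-Weil polynomials of degree $2g$. For a positive real $r$, $r^{1/n}$ and $\sqrt[n]{r}$ denote the positive real $n$-th root; in all other cases these symbols denote an arbitrary complex $n$-th root. *)

(* Defs.v *)
(* algebraic complex numbers algC *)
From mathcomp Require Import all_boot all_order all_algebra all_field.
Set Implicit Arguments. Unset Strict Implicit. Unset Printing Implicit Defensive.
Import Order.TTheory GRing.Theory Num.Theory.
Local Open Scope ring_scope.

(* q-Weil polynomials of degree 2g: monic integer polynomials of degree 2g,
   g > 0, whose complex roots (with multiplicity) are w_1, conj w_1, ...,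
   w_g, conj w_g with |w_i| = sqrt q. *)
Definition weil (q g : nat) (p : {poly int}) : Prop :=
  (0 < g)%N /\ p \is monic /\ size p = (2 * g).+1 /\
  exists s : seq algC, size s = g /\ (forall w, w \in s -> `|w| = sqrtC q%:R) /\
    map_poly (fun z : int => z%:~R : algC) p
      = \prod_(w <- s) (('X - w%:P) * ('X - (w^*)%:P)).

Definition hpoly (q : nat) (a1 a2 a3 a4 : int) : {poly int} :=
  'X^8 + a1%:P * 'X^7 + a2%:P * 'X^6 + a3%:P * 'X^5 + a4%:P * 'X^4
  + (a3 * q%:Z)%:P * 'X^3 + (a2 * q%:Z ^+ 2)%:P * 'X^2
  + (a1 * q%:Z ^+ 3)%:P * 'X + (q%:Z ^+ 4)%:P.

Definition has_real_root (p : {poly int}) : Prop :=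
  exists x : algC, x \is Num.real /\ root (map_poly (fun z : int => z%:~R : algC) p) x.

Section Conds.
Variables (q : nat) (a1 a2 a3 a4 : int).
Let A1 : algC := a1%:~R.
Let A2 : algC := a2%:~R.
Let A3 : algC := a3%:~R.
Let A4 : algC := a4%:~R.
Let Q : algC := q%:R.
Let sq : algC := sqrtC Q.

Definition cond_a : Prop := `|A1| <= 8 * sq.
Definition cond_bs : Prop := 6 * sq * `|A1| - 20 * Q <= A2.
Definition cond_b : Prop := A2 <= 3 / 8 * A1 ^+ 2 + 4 * Q.
Definition cond_c_lo : Prop := - 9 * Q * A1 - 4 * sq * A2 - 16 * Q * sq <= A3.
Definition cond_c_hi : Prop := A3 <= - 9 * Q * A1 + 4 * sq * A2 + 16 * Q * sq.
Definition cond_c : Prop := cond_c_lo /\ cond_c_hi.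
(* (9a1^2 - 24a2 + 96q)^{3/2} := (sqrt(9a1^2 - 24a2 + 96q))^3 *)
Definition pow32 : algC := (sqrtC (9 * A1 ^+ 2 - 24 * A2 + 96 * Q)) ^+ 3.
Definition dmid : algC := 1 / 2 * A1 * A2 - 1 / 8 * A1 ^+ 3 + Q * A1.
Definition cond_d : Prop :=
  dmid - 1 / 216 * pow32 <= A3 /\ A3 <= dmid + 1 / 216 * pow32.
Definition cond_e : Prop :=
  2 * sq * `|Q * A1 + A3| - 2 * Q * A2 - 2 * Q ^+ 2 <= A4.

Definition u2 : algC := - (3 * A1 ^+ 2) / 16 + A2 / 2 - 2 * Q.
Definition u3 : algC :=
  - A1 ^+ 3 / 32 + A1 * A2 / 8 + A1 * Q / 4 - A3 / 4.
Definition Delta : algC := u3 ^+ 2 + 4 * u2 ^+ 3 / 27.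

(* the k-th element of S, for given choices zeta, sqrt(Delta), omega *)
Definition Selt (zeta sD omega : algC) (k : nat) : algC :=
  - zeta ^+ k * omega * (9 * u3 / 2 + 3 * sD / 2)
  - zeta ^- k * omega^* * (9 * u3 / 2 - 3 * sD / 2)
  + 2 * u2 ^+ 2 / 3.

Definition Sseq (zeta sD omega : algC) : seq algC :=
  [:: Selt zeta sD omega 0; Selt zeta sD omega 1; Selt zeta sD omega 2].

(* theta_1 <= theta_2 <= theta_3 : the sorted elements of S *)
Definition thetas (zeta sD omega : algC) : seq algC :=
  sort (fun x y : algC => x <= y) (Sseq zeta sD omega).

Definition fconst : algC :=
  3 / 256 * A1 ^+ 4 - 1 / 16 * A1 ^+ 2 * A2 - 1 / 2 * Q * A1 ^+ 2
  + 1 / 4 * A1 * A3 + 2 * Q * A2 - 2 * Q ^+ 2.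

Definition cond_f (zeta sD omega : algC) : Prop :=
  fconst + nth 0 (thetas zeta sD omega) 0 <= A4 /\
  A4 <= fconst + nth 0 (thetas zeta sD omega) 1.
End Conds.

Definition is_square (q : nat) : Prop := exists r : nat, q = (r ^ 2)%N.

(* Main.v *)
(* Writing h(x) = x^4 g(x + q/x), the polynomial h is q-Weil iff the quartic g
   has four roots in [-2 sqrt q, 2 sqrt q].  Given that the roots are real, the
   interval condition says that the elementary symmetric functions of the gaps
   2 sqrt q - x_i and 2 sqrt q + x_i are nonnegative, which is (a), (b* ), (c),
   (e); equality means that some gap vanishes.  The roots are real iff g' has
   real roots g1 <= g2 <= g3, i.e. (b), (d) (nonpositive discriminant), and
   g(g1) <= 0 <= g(g2), g(g3) <= 0, which is (f) because Cardano's formula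
   identifies S with the critical values of g up to sign and translation. *)

Require Import Defs.
From mathcomp Require Import all_boot all_order all_algebra all_field.
From mathcomp Require Import ring lra.
Import Order.TTheory GRing.Theory Num.Theory.
Local Open Scope ring_scope.
Set Implicit Arguments. Unset Strict Implicit. Unset Printing Implicit Defensive.

Local Notation mapC := (map_poly (fun z : int => z%:~R : algC)).

(** The passage between real roots and signs at the critical points rests on algebraic identities,
    without any continuity argument, over the ordered field [algR] of real algebraic numbers and
    with s = sqrt q as parameter. A non-real root would give a factor (y - m)^2 + n^2 with n
    nonzero, and the convex cofactor would inherit the three signs at successive critical points.
    The signs are not strict, so coinciding critical points need an argument of their own. In the
    other direction, the product of the three critical values is a square up to a positive constant,
    which settles the sign at the middle point. The constants in (d) and (f) come from translating g
    by a_1/4. This turns g into y^4 + 2 u_2 y^2 - 4 u_3 y + (a_4 - [fconst]), and y^3 + u_2 y - u_3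
    has discriminant -27 Delta. That S may use conj omega as the second radical of Cardano's formula
    is due to Delta <= 0, which makes sqrt Delta purely imaginary. *)

(** * Signs of numbers and of their elementary symmetric functions *)

Lemma ge0_of_esym4 (R : realFieldType) (d1 d2 d3 d4 : R) :
    0 <= d1 + d2 + d3 + d4 ->
    0 <= d1 * d2 + d1 * d3 + d1 * d4 + d2 * d3 + d2 * d4 + d3 * d4 ->
    0 <= d1 * d2 * d3 + d1 * d2 * d4 + d1 * d3 * d4 + d2 * d3 * d4 ->
    0 <= d1 * d2 * d3 * d4 ->
  0 <= d1.
Proof.
set e1 := d1 + d2 + d3 + d4; set e2 := d1 * d2 + _ + _ + _ + _ + _.
set e3 := d1 * d2 * d3 + _ + _ + _; set e4 := d1 * d2 * d3 * d4
  => e1_ge0 e2_ge0 e3_ge0 e4_ge0.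
rewrite leNgt; apply/negP => d1_lt0.
(* Descartes' rule of signs: [d1] is a root of X^4 - e1 X^3 + e2 X^2 - e3 X + e4, where at a
   negative argument no term is negative and X^4 is positive. *)
have : d1 ^+ 4 = e1 * d1 ^+ 3 - e2 * d1 ^+ 2 + e3 * d1 - e4.
  by rewrite /e1 /e2 /e3 /e4; ring.
have d1_le0 := ltW d1_lt0.
have d12 : 0 <= d1 ^+ 2 by exact: sqr_ge0.
have : 0 < d1 ^+ 4 by rewrite exprn_even_gt0 //= lt_eqF.
have : e1 * d1 ^+ 3 <= 0 by rewrite mulr_ge0_le0 // exprn_odd_le0.
have : 0 <= e2 * d1 ^+ 2 by rewrite mulr_ge0.
have : e3 * d1 <= 0 by rewrite mulr_ge0_le0.
lra.
Qed.

Lemma esym4_ge0 (R : realFieldType) (d1 d2 d3 d4 : R) :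
    0 <= d1 -> 0 <= d2 -> 0 <= d3 -> 0 <= d4 ->
  [/\ 0 <= d1 + d2 + d3 + d4,
      0 <= d1 * d2 + d1 * d3 + d1 * d4 + d2 * d3 + d2 * d4 + d3 * d4,
      0 <= d1 * d2 * d3 + d1 * d2 * d4 + d1 * d3 * d4 + d2 * d3 * d4 &
      0 <= d1 * d2 * d3 * d4].
Proof. by move=> *; split; rewrite !(mulr_ge0, addr_ge0). Qed.

Lemma esym4_gt0 (R : realFieldType) (d1 d2 d3 d4 : R) :
    0 < d1 -> 0 < d2 -> 0 < d3 -> 0 < d4 ->
  [/\ 0 < d1 + d2 + d3 + d4,
      0 < d1 * d2 + d1 * d3 + d1 * d4 + d2 * d3 + d2 * d4 + d3 * d4,
      0 < d1 * d2 * d3 + d1 * d2 * d4 + d1 * d3 * d4 + d2 * d3 * d4 &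
      0 < d1 * d2 * d3 * d4].
Proof. by move=> *; split; rewrite !(mulr_gt0, addr_gt0). Qed.

(** If no [d] vanished, all would be positive, and so would every symmetric function. Thus equality
    in any of the bounds forces equality in the last one, the bound on the product. *)
Lemma esym4_eq0 (R : realFieldType) (d1 d2 d3 d4 : R) :
    0 <= d1 -> 0 <= d2 -> 0 <= d3 -> 0 <= d4 ->
    [\/ d1 + d2 + d3 + d4 = 0,
        d1 * d2 + d1 * d3 + d1 * d4 + d2 * d3 + d2 * d4 + d3 * d4 = 0,
        d1 * d2 * d3 + d1 * d2 * d4 + d1 * d3 * d4 + d2 * d3 * d4 = 0 |
        d1 * d2 * d3 * d4 = 0] ->
  d1 * d2 * d3 * d4 = 0.
Proof.
move=> d1p d2p d3p d4p e0; apply/eqP; apply: contraT => nz.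
have /and4P[z1 z2 z3 z4] : [&& d1 != 0, d2 != 0, d3 != 0 & d4 != 0].
  by move: nz; rewrite !mulf_eq0 !negb_or -!andbA.
have [||||p1 p2 p3 p4] := @esym4_gt0 _ d1 d2 d3 d4;
  rewrite ?lt_def ?z1 ?z2 ?z3 ?z4 //.
by case: e0 => e0; move: p1 p2 p3 p4; rewrite e0 ltxx.
Qed.

(** * The depressed quartic at its critical points *)

Section DepressedQuartic.

Variables (R : realFieldType) (u v c : R).

(* [dquartic' = 4 (y^3 + u y - v)], so at a critical point [g] the value is
   [c - dvalue g]: the elements of S are the [dvalue g]. *)
Definition dquartic (y : R) : R := y ^+ 4 + 2 * u * y ^+ 2 - 4 * v * y + c.
Definition dvalue (y : R) : R := - u * y ^+ 2 + 3 * v * y.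

Variables (g1 g2 g3 : R).
Hypotheses (g_sum : g1 + g2 + g3 = 0)
  (g_sum2 : g1 * g2 + g1 * g3 + g2 * g3 = u) (g_prod : g1 * g2 * g3 = v).

Lemma dquartic_crit :
  [/\ dquartic g1 = c - dvalue g1, dquartic g2 = c - dvalue g2
    & dquartic g3 = c - dvalue g3].
Proof.
rewrite /dquartic /dvalue -g_prod -g_sum2.
have -> : g3 = - g1 - g2 by rewrite -[RHS]addr0 -g_sum; ring.
by split; ring.
Qed.

Hypotheses (g12 : g1 <= g2) (g23 : g2 <= g3).

Lemma dquartic_min_left y : y <= g2 -> dquartic g1 <= dquartic y.
Proof.
move=> yg2; rewrite -subr_ge0.
pose b := g2 - g1; pose d := g3 - g1; pose x := y - g1.
(* In x = y - g1 this difference is the integral of 4 x (x - b) (x - d) from 0, whence the factor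
   x^2. *)
have -> : dquartic y - dquartic g1
    = x ^+ 2 * (x ^+ 2 - 4 / 3 * (b + d) * x + 2 * b * d).
  rewrite /dquartic -g_prod -g_sum2 /x /b /d.
  have -> : g3 = - g1 - g2 by rewrite -[RHS]addr0 -g_sum; ring.
  by field.
apply: mulr_ge0; first exact: sqr_ge0.
have b0 : 0 <= b by rewrite subr_ge0.
have bd : b <= d by rewrite lerD2r.
have xb : x <= b by rewrite lerD2r.
have [x0|x0] := lerP x 0.
  have : 0 <= (b + d) * - x by apply: mulr_ge0; lra.
  have : 0 <= b * d by apply: mulr_ge0; lra.
  have := sqr_ge0 x.
  lra.
(* The second factor is 4/3 h1 + h2 + 2/3 h3 + 2/3 h4 + 1/3 h5, each name standing for the product
   that it bounds. *)
have h1 : 0 <= (b - x) * (d - b) by apply: mulr_ge0; lra.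
have h2 : 0 <= (b - x) * (b - x) by apply: mulr_ge0; lra.
have h3 : 0 <= b * (d - b) by apply: mulr_ge0; lra.
have h4 : 0 <= b * (b - x) by apply: mulr_ge0; lra.
have h5 : 0 <= b * b by apply: mulr_ge0; lra.
nra.
Qed.

End DepressedQuartic.

(** The reflection y -> -y changes only the sign of v and reverses the order of the critical points,
    so facts about the leftmost one yield facts about the rightmost one. *)
Lemma dquartic_opp (R : realFieldType) (u v c y : R) :
  dquartic u (- v) c (- y) = dquartic u v c y.
Proof. by rewrite /dquartic; ring. Qed.

Lemma dquartic_min_right (R : realFieldType) (u v c g1 g2 g3 y : R) :
    g1 + g2 + g3 = 0 -> g1 * g2 + g1 * g3 + g2 * g3 = u -> g1 * g2 * g3 = v ->
    g1 <= g2 -> g2 <= g3 -> g2 <= y ->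
  dquartic u v c g3 <= dquartic u v c y.
Proof.
move=> s1 s2 s3 g12 g23 gy.
rewrite -[X in X <= _]dquartic_opp -[X in _ <= X]dquartic_opp.
apply: (@dquartic_min_left _ _ _ _ _ (- g2) (- g1)); rewrite ?lerN2 //.
- by rewrite -[RHS]oppr0 -s1; ring.
- by rewrite -s2; ring.
- by rewrite -s3; ring.
Qed.

(* If the value at the leftmost critical point were positive, all roots would
   lie to its right, making the derivative nonzero there. *)
Lemma dquartic_crit_left_le0 (R : realFieldType)
    (u v c g1 g2 g3 t1 t2 t3 t4 : R) :
    g1 + g2 + g3 = 0 -> g1 * g2 + g1 * g3 + g2 * g3 = u -> g1 * g2 * g3 = v ->
    g1 <= g2 -> g2 <= g3 ->
    (forall y, dquartic u v c y = (y - t1) * (y - t2) * (y - t3) * (y - t4)) ->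
    t1 + t2 + t3 + t4 = 0 ->
    t1 * t2 * t3 + t1 * t2 * t4 + t1 * t3 * t4 + t2 * t3 * t4 = 4 * v ->
    t1 * t2 + t1 * t3 + t1 * t4 + t2 * t3 + t2 * t4 + t3 * t4 = 2 * u ->
  dquartic u v c g1 <= 0.
Proof.
move=> s1 s2 s3 g12 g23 ft e1 e3 e2.
rewrite leNgt; apply/negP => fg1.
have gt y : dquartic u v c y = 0 -> 0 < y - g1.
  move=> fy; rewrite subr_gt0 ltNge; apply/negP => yg.
  have := dquartic_min_left c s1 s2 s3 g12 g23 (le_trans yg g12).
  by rewrite fy leNgt fg1.
have p1 : 0 < t1 - g1 by apply: gt; rewrite ft subrr !mul0r.
have p2 : 0 < t2 - g1 by apply: gt; rewrite ft subrr mulr0 !mul0r.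
have p3 : 0 < t3 - g1 by apply: gt; rewrite ft subrr mulr0 !mul0r.
have p4 : 0 < t4 - g1 by apply: gt; rewrite ft subrr mulr0.
have [_ _ + _] := esym4_gt0 p1 p2 p3 p4.
set d1 := t1 - g1; set d2 := t2 - g1; set d3 := t3 - g1; set d4 := t4 - g1.
suff -> : d1 * d2 * d3 + d1 * d2 * d4 + d1 * d3 * d4 + d2 * d3 * d4 = 0.
  by rewrite ltxx.
(* This symmetric function is minus the derivative of the quartic at [g1], that is -4 (g1^3 + u g1 -
   v). *)
have -> : d1 * d2 * d3 + d1 * d2 * d4 + d1 * d3 * d4 + d2 * d3 * d4 =
   4 * v - 2 * g1 * (2 * u) + 3 * g1 ^+ 2 * 0 - 4 * g1 ^+ 3.
  by rewrite -e1 -e2 -e3 /d1 /d2 /d3 /d4; ring.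
rewrite -s2 -s3; have -> : g3 = - g1 - g2 by rewrite -[RHS]addr0 -s1; ring.
by ring.
Qed.

Lemma dquartic_rootsE (R : realFieldType) (u v c t1 t2 t3 t4 : R) :
    t1 + t2 + t3 + t4 = 0 ->
    t1 * t2 + t1 * t3 + t1 * t4 + t2 * t3 + t2 * t4 + t3 * t4 = 2 * u ->
    t1 * t2 * t3 + t1 * t2 * t4 + t1 * t3 * t4 + t2 * t3 * t4 = 4 * v ->
    t1 * t2 * t3 * t4 = c ->
  forall y, dquartic u v c y = (y - t1) * (y - t2) * (y - t3) * (y - t4).
Proof.
move=> e1 e2 e3 e4 y; rewrite /dquartic.
have -> : (y - t1) * (y - t2) * (y - t3) * (y - t4) =
  y ^+ 4 - (t1 + t2 + t3 + t4) * y ^+ 3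
  + (t1 * t2 + t1 * t3 + t1 * t4 + t2 * t3 + t2 * t4 + t3 * t4) * y ^+ 2
  - (t1 * t2 * t3 + t1 * t2 * t4 + t1 * t3 * t4 + t2 * t3 * t4) * y
  + t1 * t2 * t3 * t4 by ring.
by rewrite e1 e2 e3 e4; ring.
Qed.

(** If an outer value vanishes, its minimality gives the middle sign. Otherwise both outer values
    are negative, and the middle value has the sign of the product of all three. That product is the
    discriminant of the quartic divided by 256, a square since the roots lie in [R]. *)
Lemma dquartic_crit_sign (R : realFieldType)
    (u v c g1 g2 g3 t1 t2 t3 t4 : R) :
    g1 + g2 + g3 = 0 -> g1 * g2 + g1 * g3 + g2 * g3 = u -> g1 * g2 * g3 = v ->
    g1 <= g2 -> g2 <= g3 ->
    t1 + t2 + t3 + t4 = 0 ->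
    t1 * t2 + t1 * t3 + t1 * t4 + t2 * t3 + t2 * t4 + t3 * t4 = 2 * u ->
    t1 * t2 * t3 + t1 * t2 * t4 + t1 * t3 * t4 + t2 * t3 * t4 = 4 * v ->
    t1 * t2 * t3 * t4 = c ->
  [/\ dquartic u v c g1 <= 0, 0 <= dquartic u v c g2
    & dquartic u v c g3 <= 0].
Proof.
move=> s1 s2 s3 g12 g23 e1 e2 e3 e4.
have ft := dquartic_rootsE e1 e2 e3 e4.
have f1 : dquartic u v c g1 <= 0.
  exact: (dquartic_crit_left_le0 s1 s2 s3 g12 g23 ft).
have f3 : dquartic u v c g3 <= 0.
  rewrite -dquartic_opp.
  apply: (@dquartic_crit_left_le0 _ _ _ _ _ (- g2) (- g1)
           (- t1) (- t2) (- t3) (- t4)); rewrite ?lerN2 //.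
  - by rewrite -[RHS]oppr0 -s1; ring.
  - by rewrite -s2; ring.
  - by rewrite -s3; ring.
  - by move=> y; rewrite -[y]opprK dquartic_opp ft; ring.
  - by rewrite -[RHS]oppr0 -e1; ring.
  - by rewrite [RHS]mulrN -e3; ring.
  - by rewrite -e2; ring.
split=> //.
have [f10|f1n] := eqVneq (dquartic u v c g1) 0.
  by rewrite -f10 (dquartic_min_left c s1 s2 s3).
have [f30|f3n] := eqVneq (dquartic u v c g3) 0.
  by rewrite -f30 (dquartic_min_right c s1 s2 s3).
have f13 : 0 < dquartic u v c g1 * dquartic u v c g3.
  by rewrite nmulr_rgt0 lt_neqAle ?f1n ?f3n ?f1 ?f3.
rewrite -(pmulr_rge0 _ f13).
(* prod_i f(g_i) = prod_j (f'(t_j) / 4) *)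
pose d t := t ^+ 3 + u * t - v.
have gE t : d t = (t - g1) * (t - g2) * (t - g3).
  rewrite /d -s2 -s3; have -> : g3 = - g1 - g2 by rewrite -[RHS]addr0 -s1; ring.
  by ring.
have dE t : 4 * d t = 4 * t ^+ 3 - 3 * (t1 + t2 + t3 + t4) * t ^+ 2 +
   2 * (t1 * t2 + t1 * t3 + t1 * t4 + t2 * t3 + t2 * t4 + t3 * t4) * t -
   (t1 * t2 * t3 + t1 * t2 * t4 + t1 * t3 * t4 + t2 * t3 * t4).
  by rewrite e1 e2 e3 /d; ring.
have -> : dquartic u v c g1 * dquartic u v c g3 * dquartic u v c g2 =
  d t1 * d t2 * d t3 * d t4 by rewrite !gE !ft; ring.
rewrite -(pmulr_rge0 _ (_ : 0 < 256)) //.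
have -> : 256 * (d t1 * d t2 * d t3 * d t4) =
  (4 * d t1) * (4 * d t2) * (4 * d t3) * (4 * d t4) by ring.
have -> : 4 * d t1 * (4 * d t2) * (4 * d t3) * (4 * d t4) =
  ((t1 - t2) * (t1 - t3) * (t1 - t4) * (t2 - t3) * (t2 - t4) * (t3 - t4)) ^+ 2.
  by rewrite !dE; ring.
exact: sqr_ge0.
Qed.

(* [dquartic] splits as [((y - m)^2 + N - m^2) * k] with [k] convex; if [m^2 < N]
   then [k] would have to be [<= 0, >= 0, <= 0] at [g1 <= g2 <= g3]. *)
Lemma dquartic_crit_sign_split (R : realFieldType)
    (u v c g1 g2 g3 m N r : R) :
    g1 + g2 + g3 = 0 -> g1 * g2 + g1 * g3 + g2 * g3 = u -> g1 * g2 * g3 = v ->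
    g1 <= g2 -> g2 <= g3 ->
    2 * u = r - 4 * m ^+ 2 + N -> 4 * v = 2 * m * (r - N) -> c = N * r ->
    dquartic u v c g1 <= 0 -> 0 <= dquartic u v c g2 ->
    dquartic u v c g3 <= 0 ->
  N <= m ^+ 2.
Proof.
move=> s1 s2 s3 g12 g23 uE vE cE f1 f2 f3.
rewrite leNgt; apply/negP => n0.
pose k y := y ^+ 2 + 2 * m * y + r; pose K y := (y - m) ^+ 2 + (N - m ^+ 2).
have K0 y : 0 < K y by apply: ltr_wpDl; [exact: sqr_ge0|rewrite subr_gt0].
have fE y : dquartic u v c y = K y * k y.
  by rewrite /dquartic uE vE cE /k /K; ring.
have k1 : k g1 <= 0 by rewrite -(pmulr_rle0 _ (K0 g1)) -fE.
have k2 : 0 <= k g2 by rewrite -(pmulr_rge0 _ (K0 g2)) -fE.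
have k3 : k g3 <= 0 by rewrite -(pmulr_rle0 _ (K0 g3)) -fE.
(* At a double root g of the cubic, k(g) = 0 and the vanishing derivative of K k give k'(g) = 2 (g +
   m) = 0. Then g = -m and r = m^2, and u = -3 m^2 turns the relation for 2u into N = -3 m^2,
   against m^2 < N. *)
have double g : k g = 0 -> g ^+ 3 + u * g - v = 0 -> u = - 3 * g ^+ 2 -> False.
  move=> kg dg ug.
  have : K g * (2 * (g + m)) = 0.
    have -> : K g * (2 * (g + m)) =
      4 * g ^+ 3 + 2 * (r - 4 * m ^+ 2 + N) * g - 2 * m * (r - N)
      - 2 * (g - m) * k g by rewrite /K /k; ring.
    by rewrite -uE -vE kg mulr0 subr0 -[RHS](mulr0 4) -dg; ring.
  move/eqP; rewrite mulf_eq0 gt_eqF ?K0 //= mulf_eq0 pnatr_eq0 /= => /eqP gm.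
  have {}gm : g = - m by apply/eqP; rewrite -addr_eq0 gm.
  move: kg uE; rewrite ug gm /k => kg uE.
  have := sqr_ge0 m; move: n0; lra.
have d1 g : g ^+ 3 + u * g - v = (g - g1) * (g - g2) * (g - g3).
  rewrite -s2 -s3; have -> : g3 = - g1 - g2 by rewrite -[RHS]addr0 -s1; ring.
  by ring.
have [e12|n12] := eqVneq g1 g2.
  apply: (double g1); rewrite ?d1 ?subrr ?mul0r //.
    by apply/eqP; rewrite eq_le k1 e12 k2.
  rewrite -s2 (_ : g3 = - g1 - g2) -?e12; first by ring.
  by rewrite -[RHS]addr0 -s1 e12; ring.
have [e23|n23] := eqVneq g2 g3.
  apply: (double g3); rewrite ?d1 ?subrr ?mulr0 //.
    by apply/eqP; rewrite eq_le k3 -e23 k2.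
  rewrite -s2 (_ : g1 = - g2 - g3) ?e23; first by ring.
  by rewrite -[RHS]addr0 -s1 e23; ring.
have p12 : 0 < g2 - g1 by rewrite subr_gt0 lt_neqAle n12.
have p23 : 0 < g3 - g2 by rewrite subr_gt0 lt_neqAle n23.
(* For distinct critical points, interpolating the monic quadratic k at g1 and g3 puts k(g2) below
   the chord by (g2 - g1) (g3 - g2). *)
have := mulr_gt0 (mulr_gt0 p12 p23) (addr_gt0 p12 p23).
have : (g3 - g2) * k g1 <= 0 by rewrite pmulr_rle0.
have : (g2 - g1) * k g3 <= 0 by rewrite pmulr_rle0.
have : 0 <= (g2 - g1 + (g3 - g2)) * k g2 by rewrite mulr_ge0 // ltW // addr_gt0.
have -> : (g2 - g1 + (g3 - g2)) * k g2 = (g3 - g2) * k g1 + (g2 - g1) * k g3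
  - (g2 - g1) * (g3 - g2) * (g2 - g1 + (g3 - g2)) by rewrite /k; ring.
lra.
Qed.

(** * Weil polynomials through the traces w + conj w *)

Lemma sqrtC_nat_real (q : nat) : sqrtC (q%:R : algC) \is Num.real.
Proof. by rewrite ger0_real // sqrtC_ge0. Qed.

Definition rsqrt (q : nat) : algR := in_algR (sqrtC_nat_real q).

Lemma algR_leE (x y : algR) : (x <= y) = (algRval x <= algRval y).
Proof. by []. Qed.

Lemma algRval_inj : injective algRval. Proof. exact: val_inj. Qed.

Lemma rsqrt_ge0 q : 0 <= rsqrt q.
Proof. by rewrite algR_leE rmorph0 sqrtC_ge0. Qed.

Lemma rsqrtK q : rsqrt q ^+ 2 = q%:R.
Proof. by apply: algRval_inj; rewrite rmorphXn rmorph_nat /= sqrtCK. Qed.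

(* If [w] has modulus [s], then [(X - w) (X - w^* )] is [qfactor s (w + w^* )]. *)
Definition qfactor (s x : algR) : {poly algC} :=
  'X^2 - (algRval x)%:P * 'X + (algRval s ^+ 2)%:P.

Lemma qfactor_lead s x : qfactor s x \is monic /\ size (qfactor s x) = 3%N.
Proof.
have qE : qfactor s x = 'X^2 + (- (algRval x)%:P * 'X + (algRval s ^+ 2)%:P).
  by rewrite /qfactor mulNr addrA.
have sz :
    (size (- (algRval x)%:P * 'X + (algRval s ^+ 2)%:P : {poly algC})%R < 3)%N.
  rewrite -polyCN size_MXaddC; case: ifP => // _; rewrite ltnS.
  by apply: leq_ltn_trans (size_polyC_leq1 _) _.
split; last by rewrite qE size_polyDl size_polyXn.
by rewrite monicE qE lead_coefDl ?size_polyXn // lead_coefXn.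
Qed.

Lemma qfactor_conj (w : algC) (s x : algR) :
  w * w^* = algRval s ^+ 2 -> w + w^* = algRval x ->
  ('X - w%:P) * ('X - (w^*)%:P) = qfactor s x.
Proof.
by rewrite /qfactor => <- <-; rewrite polyCM polyCD; ring.
Qed.

(** The bound on a trace x = 2 Re w is |Re w| <= |w|. Conversely x comes from w = (x + i sqrt(4 s^2
    - x^2)) / 2: the bound makes the square root real, so that conj w is the other root of the
    factor and |w| = s. *)
Lemma weilP (q g : nat) (p : {poly int}) :
  weil q g p <-> (0 < g)%N /\ exists xs : seq algR,
    [/\ size xs = g, {in xs, forall x, - (2 * rsqrt q) <= x <= 2 * rsqrt q}
      & (mapC p) = \prod_(x <- xs) qfactor (rsqrt q) x].
Proof.
split=> [[g_gt0 [_ [_ [s [ss [sN pE]]]]]]|[g_gt0 [xs [sxs xsB pE]]]].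
  split=> //; exists [seq in_algR (Creal_Re w) *+ 2 | w <- s].
  split; first by rewrite size_map.
    move=> _ /mapP[w ws ->]; rewrite -ler_norml.
    rewrite normrMn -[X in X <= _]mulr_natl ler_pM2l ?ltr0n //.
    by rewrite algR_leE /= -(sN w ws) leif_normC_Re_Creal.
  rewrite pE big_map !big_seq; apply: eq_bigr => w ws; apply: qfactor_conj.
    by rewrite -normCK sN.
  by rewrite rmorphMn /= ReE -[RHS]mulr_natr divfK ?pnatr_eq0.
have lead : (mapC p) \is monic /\ size (mapC p) = (2 * g).+1.
  rewrite pE; split.
    by apply: monic_prod => x _; case: (qfactor_lead (rsqrt q) x).
  rewrite size_prod_seq; last first.
    by move=> x _; rewrite monic_neq0 //; case: (qfactor_lead (rsqrt q) x).
  rewrite (eq_bigr (fun => 3%N)); last first.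
    by move=> x _; case: (qfactor_lead (rsqrt q) x).
  rewrite big_const_seq count_predT sxs iter_addn_0.
  by rewrite subSn ?leq_pmull // mulSn addKn.
have [pm psz] := lead; split=> //; split.
  by move: pm;
    rewrite !monicE (lead_coef_map_inj (@intr_inj algC)) // -(eqr_int algC).
split; first by rewrite -psz (size_map_inj_poly (@intr_inj algC)).
pose y x := sqrtC (algRval (4 * rsqrt q ^+ 2 - x ^+ 2)).
pose w x := (algRval x + 'i * y x) / 2.
have wc x : x \in xs -> (w x)^* = (algRval x - 'i * y x) / 2.
  move=> xxs; have /andP[x1 x2] := xsB x xxs.
  have y_real : y x \is Num.real.
    rewrite ger0_real // sqrtC_ge0 -[0]/(algRval 0) -algR_leE.
    have -> : 4 * rsqrt q ^+ 2 - x ^+ 2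
        = (2 * rsqrt q - x) * (2 * rsqrt q + x) by ring.
    by rewrite mulr_ge0 //; move: x1 x2; lra.
  rewrite /w; move: (y x) y_real => Y Y_real.
  rewrite rmorphM fmorphV rmorph_nat rmorphD rmorphM /= conjCi mulNr.
  by rewrite (CrealP Y_real) (CrealP (algRvalP x)).
have wM x : x \in xs -> w x * (w x)^* = algRval (rsqrt q) ^+ 2.
  move=> xxs; rewrite wc // /w.
  have -> : (algRval x + 'i * y x) / 2 * ((algRval x - 'i * y x) / 2) =
    (algRval x ^+ 2 - 'i ^+ 2 * y x ^+ 2) / 4 by field.
  by rewrite sqrCi sqrtCK rmorphB rmorphM !rmorphXn rmorph_nat; field.
exists [seq w x | x <- xs]; split; first by rewrite size_map.
split.
  move=> _ /mapP[x xxs ->]; apply/eqP; rewrite -(@eqrXn2 _ 2) ?sqrtC_ge0 //.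
  by rewrite normCK wM.
rewrite pE big_map !big_seq; apply: eq_bigr => x xxs; symmetry.
by apply: qfactor_conj; rewrite ?wM // wc // /w; field.
Qed.

(** This is [hpoly] with q written as s^2 over an arbitrary ring, so that a product over real
    traces, whose coefficients need not be integers, has the same shape. *)
Definition octic (R : comNzRingType) (s a1 a2 a3 a4 : R) : {poly R} :=
  'X^8 + a1%:P * 'X^7 + a2%:P * 'X^6 + a3%:P * 'X^5 + a4%:P * 'X^4
  + (a3 * s ^+ 2)%:P * 'X^3 + (a2 * s ^+ 4)%:P * 'X^2
  + (a1 * s ^+ 6)%:P * 'X + (s ^+ 8)%:P.

Lemma octic_inj (R : comNzRingType) (s a1 a2 a3 a4 b1 b2 b3 b4 : R) :
  octic s a1 a2 a3 a4 = octic s b1 b2 b3 b4 ->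
  [/\ a1 = b1, a2 = b2, a3 = b3 & a4 = b4].
Proof.
move=> e; split.
- have := congr1 (fun p : {poly R} => p`_7) e;
    rewrite /octic !(coefD, coefCM, coefXn, coefX, coefC) /=.
  by rewrite !(mulr0, mulr1, add0r, addr0).
- have := congr1 (fun p : {poly R} => p`_6) e;
    rewrite /octic !(coefD, coefCM, coefXn, coefX, coefC) /=.
  by rewrite !(mulr0, mulr1, add0r, addr0).
- have := congr1 (fun p : {poly R} => p`_5) e;
    rewrite /octic !(coefD, coefCM, coefXn, coefX, coefC) /=.
  by rewrite !(mulr0, mulr1, add0r, addr0).
- have := congr1 (fun p : {poly R} => p`_4) e;
    rewrite /octic !(coefD, coefCM, coefXn, coefX, coefC) /=.
  by rewrite !(mulr0, mulr1, add0r, addr0).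
Qed.

Lemma map_hpoly (q : nat) (a1 a2 a3 a4 : int) :
  mapC (hpoly q a1 a2 a3 a4)
  = octic (algRval (rsqrt q)) a1%:~R a2%:~R a3%:~R a4%:~R.
Proof.
have sE : algRval (rsqrt q) ^+ 2 = q%:~R by rewrite /= sqrtCK.
have [s4 s6 s8] : [/\ algRval (rsqrt q) ^+ 4 = q%:~R ^+ 2,
    algRval (rsqrt q) ^+ 6 = q%:~R ^+ 3 & algRval (rsqrt q) ^+ 8 = q%:~R ^+ 4].
  by rewrite -sE -!exprM.
rewrite /hpoly /octic sE s4 s6 s8.
by rewrite !(rmorphD, rmorphM, rmorphXn) /= !map_polyC map_polyX.
Qed.

(** Here [X] is an element of any commutative ring, which keeps the identity within reach of [ring];
    it is applied in the polynomial ring to the indeterminate and to constants. *)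
Lemma prod_quadraticE (A : comNzRingType) (X s x1 x2 x3 x4 : A) :
  (X ^+ 2 - x1 * X + s ^+ 2) * ((X ^+ 2 - x2 * X + s ^+ 2) *
    ((X ^+ 2 - x3 * X + s ^+ 2) * (X ^+ 2 - x4 * X + s ^+ 2))) =
  X ^+ 8 + (- (x1 + x2 + x3 + x4)) * X ^+ 7
  + (x1 * x2 + x1 * x3 + x1 * x4 + x2 * x3 + x2 * x4 + x3 * x4 + 4 * s ^+ 2)
    * X ^+ 6
  + (- (x1 * x2 * x3 + x1 * x2 * x4 + x1 * x3 * x4 + x2 * x3 * x4)
     - 3 * s ^+ 2 * (x1 + x2 + x3 + x4)) * X ^+ 5
  + (x1 * x2 * x3 * x4 + 2 * s ^+ 2 *
     (x1 * x2 + x1 * x3 + x1 * x4 + x2 * x3 + x2 * x4 + x3 * x4) + 6 * s ^+ 4)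
    * X ^+ 4
  + (- (x1 * x2 * x3 + x1 * x2 * x4 + x1 * x3 * x4 + x2 * x3 * x4)
     - 3 * s ^+ 2 * (x1 + x2 + x3 + x4)) * s ^+ 2 * X ^+ 3
  + (x1 * x2 + x1 * x3 + x1 * x4 + x2 * x3 + x2 * x4 + x3 * x4 + 4 * s ^+ 2)
    * s ^+ 4 * X ^+ 2
  + (- (x1 + x2 + x3 + x4)) * s ^+ 6 * X + s ^+ 8.
Proof. by ring. Qed.

Lemma prod_quadratic_octic (R : comNzRingType) (s x1 x2 x3 x4 : R) :
  \prod_(x <- [:: x1; x2; x3; x4]) ('X^2 - x%:P * 'X + (s ^+ 2)%:P) =
  octic s
   (- (x1 + x2 + x3 + x4))
   (x1 * x2 + x1 * x3 + x1 * x4 + x2 * x3 + x2 * x4 + x3 * x4 + 4 * s ^+ 2)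
   (- (x1 * x2 * x3 + x1 * x2 * x4 + x1 * x3 * x4 + x2 * x3 * x4)
     - 3 * s ^+ 2 * (x1 + x2 + x3 + x4))
   (x1 * x2 * x3 * x4 + 2 * s ^+ 2 *
     (x1 * x2 + x1 * x3 + x1 * x4 + x2 * x3 + x2 * x4 + x3 * x4) + 6 * s ^+ 4).
Proof.
rewrite !big_cons big_nil mulr1 /octic.
rewrite !(polyCD, polyCN, polyCM, rmorphXn, rmorph_nat) /=.
exact: prod_quadraticE.
Qed.

Lemma prod_qfactorE (s x1 x2 x3 x4 : algR) :
  \prod_(x <- [:: x1; x2; x3; x4]) qfactor s x =
  octic (algRval s)
   (algRval (- (x1 + x2 + x3 + x4)))
   (algRval (x1 * x2 + x1 * x3 + x1 * x4 + x2 * x3 + x2 * x4 + x3 * x4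
     + 4 * s ^+ 2))
   (algRval (- (x1 * x2 * x3 + x1 * x2 * x4 + x1 * x3 * x4 + x2 * x3 * x4)
     - 3 * s ^+ 2 * (x1 + x2 + x3 + x4)))
   (algRval (x1 * x2 * x3 * x4 + 2 * s ^+ 2 *
     (x1 * x2 + x1 * x3 + x1 * x4 + x2 * x3 + x2 * x4 + x3 * x4) + 6 * s ^+ 4)).
Proof.
rewrite !(rmorphD, rmorphN, rmorphM, rmorphXn, rmorph_nat) -prod_quadratic_octic.
by rewrite !big_cons !big_nil.
Qed.

(* Writing [h = prod_i (X^2 - x_i X + s^2)] with [q = s^2], these are the
   coefficients of [h]; the [x_i] are the traces [w_i + conj w_i]. *)
Definition trace_roots (R : comNzRingType) (s a1 a2 a3 a4 x1 x2 x3 x4 : R) : Prop :=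
  [/\ a1 = - (x1 + x2 + x3 + x4),
      a2 = x1 * x2 + x1 * x3 + x1 * x4 + x2 * x3 + x2 * x4 + x3 * x4
           + 4 * s ^+ 2,
      a3 = - (x1 * x2 * x3 + x1 * x2 * x4 + x1 * x3 * x4 + x2 * x3 * x4)
           - 3 * s ^+ 2 * (x1 + x2 + x3 + x4) &
      a4 = x1 * x2 * x3 * x4 + 2 * s ^+ 2 *
           (x1 * x2 + x1 * x3 + x1 * x4 + x2 * x3 + x2 * x4 + x3 * x4)
           + 6 * s ^+ 4].

Lemma trace_roots_hpoly (q : nat) (a1 a2 a3 a4 : int) (x1 x2 x3 x4 : algR)
    (s := rsqrt q) :
    trace_roots s a1%:~R a2%:~R a3%:~R a4%:~R x1 x2 x3 x4 ->
  mapC (hpoly q a1 a2 a3 a4) = \prod_(x <- [:: x1; x2; x3; x4]) qfactor s x.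
Proof.
by case=> E1 E2 E3 E4; rewrite map_hpoly prod_qfactorE -E1 -E2 -E3 -E4 !rmorph_int.
Qed.

Lemma weil4P (q : nat) (a1 a2 a3 a4 : int) (s := rsqrt q) :
  weil q 4 (hpoly q a1 a2 a3 a4) <-> exists x1 x2 x3 x4 : algR,
    {in [:: x1; x2; x3; x4], forall x, - (2 * s) <= x <= 2 * s} /\
    trace_roots s a1%:~R a2%:~R a3%:~R a4%:~R x1 x2 x3 x4.
Proof.
rewrite weilP; split.
  move=> [_ [xs [sxs]]].
  case: xs sxs => [|x1 [|x2 [|x3 [|x4 []]]]] // sxs xsB.
  rewrite map_hpoly prod_qfactorE => /octic_inj[E1 E2 E3 E4].
  exists x1, x2, x3, x4; split=> //.
  by split; apply: algRval_inj; rewrite rmorph_int.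
move=> [x1 [x2 [x3 [x4 [xsB tr]]]]]; split=> //.
by exists [:: x1; x2; x3; x4]; split=> //; exact: trace_roots_hpoly.
Qed.

Lemma horner_qfactor (s x w : algR) :
  (qfactor s x).[algRval w] = algRval (w ^+ 2 - x * w + s ^+ 2).
Proof.
rewrite /qfactor !(hornerD, hornerN, hornerM, hornerC, hornerX, hornerXn).
by rewrite !(rmorphD, rmorphN, rmorphM, rmorphXn).
Qed.

(** A factor is w^2 - x w + s^2 = (w - x/2)^2 + (4 s^2 - x^2)/4. For real w and |x| <= 2s it
    vanishes only if x^2 = 4 s^2, and then w = x/2 is a root. *)
Lemma has_real_rootP (q : nat) (p : {poly int}) (xs : seq algR) :
    {in xs, forall x, - (2 * rsqrt q) <= x <= 2 * rsqrt q} ->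
    mapC p = \prod_(x <- xs) qfactor (rsqrt q) x ->
  has_real_root p <-> exists2 x, x \in xs & x ^+ 2 = (2 * rsqrt q) ^+ 2.
Proof.
set s := rsqrt q => xsB pE; rewrite /has_real_root pE; split.
  move=> [w [w_real]]; rewrite /root horner_prod prodf_seq_eq0.
  move=> /hasP[x xxs /= /eqP]; rewrite -[w]/(algRval (in_algR w_real)).
  rewrite horner_qfactor -[RHS](rmorph0 algRval) => /algRval_inj.
  have /andP[x1 x2] := xsB x xxs => xw; exists x => //; move: xw.
  set W := in_algR w_real => xw.
  have : (W - x / 2) ^+ 2 + (2 * s - x) * (2 * s + x) / 4 = 0.
    by rewrite -[RHS]xw; field.
  have : 0 <= (2 * s - x) * (2 * s + x) by apply: mulr_ge0; move: x1 x2; lra.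
  have := sqr_ge0 (W - x / 2).
  have -> : (2 * s - x) * (2 * s + x) = (2 * s) ^+ 2 - x ^+ 2 by ring.
  by lra.
move=> [x xxs] /eqP; rewrite eqf_sqr => xE.
have [w wE] : exists w, w = x / 2 by exists (x / 2).
exists (algRval w); split; first exact: algRvalP.
rewrite /root horner_prod prodf_seq_eq0; apply/hasP; exists x => //=.
rewrite horner_qfactor -(rmorph0 algRval); apply/eqP; congr algRval.
by rewrite wE; case/orP: xE => /eqP ->; field.
Qed.

(** * Splitting over a closed field, and reality of roots *)

Lemma quadratic_root (F : closedFieldType) (b c : F) :
  exists x, x ^+ 2 + b * x + c = 0.
Proof.
have [x xE] := solve_monicpoly (fun i => nth 0 [:: - c; - b] i) (isT : (0 < 2)%N).
exists x; rewrite xE !big_ord_recl big_ord0 /=; ring.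
Qed.

Lemma cubic_root (F : closedFieldType) (b c d : F) :
  exists x, x ^+ 3 + b * x ^+ 2 + c * x + d = 0.
Proof.
have [x xE] :=
  solve_monicpoly (fun i => nth 0 [:: - d; - c; - b] i) (isT : (0 < 3)%N).
exists x; rewrite xE !big_ord_recl big_ord0 /=; ring.
Qed.

Lemma quartic_root (F : closedFieldType) (b c d e : F) :
  exists x, x ^+ 4 + b * x ^+ 3 + c * x ^+ 2 + d * x + e = 0.
Proof.
have [x xE] :=
  solve_monicpoly (fun i => nth 0 [:: - e; - d; - c; - b] i) (isT : (0 < 4)%N).
exists x; rewrite xE !big_ord_recl big_ord0 /=; ring.
Qed.

(** The second root is a root of the quotient by the first linear factor, with the coefficients of
    synthetic division, and the zero sum forces the last one. The quartic is split in the same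
    way. *)
Lemma depressed_cubic_split (F : closedFieldType) (u v : F) :
  exists g1 g2 g3, [/\ g1 + g2 + g3 = 0, g1 * g2 + g1 * g3 + g2 * g3 = u
    & g1 * g2 * g3 = v].
Proof.
have [g1 g1E] := cubic_root 0 u (- v).
have [g2 g2E] := quadratic_root g1 (g1 ^+ 2 + u).
exists g1, g2, (- g1 - g2).
have uE : u = - (g2 ^+ 2 + g1 * g2 + g1 ^+ 2).
  by rewrite -[LHS](subr0 u) -g2E; ring.
have vE : v = g1 ^+ 3 + u * g1 by rewrite -[LHS](addr0 v) -g1E; ring.
by rewrite vE uE; split; ring.
Qed.

Lemma depressed_quartic_split (F : closedFieldType) (b c d : F) :
  exists t1 t2 t3 t4, [/\ t1 + t2 + t3 + t4 = 0,
    t1 * t2 + t1 * t3 + t1 * t4 + t2 * t3 + t2 * t4 + t3 * t4 = b,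
    t1 * t2 * t3 + t1 * t2 * t4 + t1 * t3 * t4 + t2 * t3 * t4 = c
    & t1 * t2 * t3 * t4 = d].
Proof.
have [t1 t1E] := quartic_root 0 b (- c) d.
have [t2 t2E] := cubic_root t1 (t1 ^+ 2 + b) (t1 ^+ 3 + b * t1 - c).
have [t3 t3E] := quadratic_root (t1 + t2) (t2 ^+ 2 + t1 * t2 + t1 ^+ 2 + b).
exists t1, t2, t3, (- (t1 + t2 + t3)).
have bE : b = - (t3 ^+ 2 + (t1 + t2) * t3 + t2 ^+ 2 + t1 * t2 + t1 ^+ 2).
  by rewrite -[LHS](subr0 b) -t3E; ring.
have cE : c = t2 ^+ 3 + t1 * t2 ^+ 2 + (t1 ^+ 2 + b) * t2 + t1 ^+ 3 + b * t1.
  by rewrite -[LHS](addr0 c) -t2E; ring.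
have dE : d = - (t1 ^+ 4 + b * t1 ^+ 2 - c * t1).
  by rewrite -[LHS](subr0 d) -t1E; ring.
by rewrite dE cE bE; split; ring.
Qed.

(* Gauss-Lucas: at a non-real critical point all the [1 / (g - t_i)] have
   imaginary parts of the same sign. *)
Lemma crit_real (C : numClosedFieldType) (g t1 t2 t3 t4 : C) :
    t1 \is Num.real -> t2 \is Num.real -> t3 \is Num.real -> t4 \is Num.real ->
    (g - t1) * (g - t2) * (g - t3) + (g - t1) * (g - t2) * (g - t4)
    + (g - t1) * (g - t3) * (g - t4) + (g - t2) * (g - t3) * (g - t4) = 0 ->
  g \is Num.real.
Proof.
move=> r1 r2 r3 r4 e3; apply: contraT => g_nreal.
have nz t : t \is Num.real -> g - t != 0.
  by move=> rt; rewrite subr_eq0; apply: contraNneq g_nreal => ->.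
have invE t : t \is Num.real ->
    (g - t)^-1 - ((g - t)^-1)^* = - `|g - t| ^- 2 * (g - g^*).
  move=> rt; have -> : g - g^* = (g - t) - (g - t)^*.
    by rewrite rmorphB /= (CrealP rt); ring.
  move: (g - t) => d; rewrite invC_norm rmorphM /= conjCK.
  by rewrite (CrealP (_ : `|d| ^- 2 \is Num.real)) ?realV ?realX //; ring.
have s0 : (g - t1)^-1 + (g - t2)^-1 + (g - t3)^-1 + (g - t4)^-1 = 0.
  move: (nz _ r1) (nz _ r2) (nz _ r3) (nz _ r4) e3.
  move: (g - t1) (g - t2) (g - t3) (g - t4) => a b c d a0 b0 c0 d0 e3.
  have -> : a^-1 + b^-1 + c^-1 + d^-1
      = (a * b * c + a * b * d + a * c * d + b * c * d) / (a * b * c * d).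
    by field; rewrite a0 b0 c0 d0.
  by rewrite e3 mul0r.
have : (`|g - t1| ^- 2 + `|g - t2| ^- 2 + `|g - t3| ^- 2 + `|g - t4| ^- 2)
    * (g - g^*) = 0.
  apply: oppr_inj; rewrite oppr0 -mulNr !opprD !mulrDl -!invE //.
  transitivity (((g - t1)^-1 + (g - t2)^-1 + (g - t3)^-1 + (g - t4)^-1)
    - ((g - t1)^-1 + (g - t2)^-1 + (g - t3)^-1 + (g - t4)^-1)^*).
    rewrite !rmorphD /=.
    move: ((g - t1)^-1) ((g - t2)^-1) ((g - t3)^-1) ((g - t4)^-1).
    by move=> a b c d; ring.
  by rewrite s0 rmorph0 subr0.
move/eqP; rewrite mulf_eq0 subr_eq0 [g == _]eq_sym -CrealE (negPf g_nreal) orbF.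
by rewrite gt_eqF // !addr_gt0 // invr_gt0 exprn_gt0 // normr_gt0 nz.
Qed.

(** The discriminant of y^3 + u y - v is -27 (v^2 + 4 u^3 / 27). It is the squared product of the
    root differences, and these roots are real by [crit_real], being critical points of a quartic
    with real roots. *)
Lemma disc_le0 (u v t1 t2 t3 t4 : algR) :
    t1 + t2 + t3 + t4 = 0 ->
    t1 * t2 + t1 * t3 + t1 * t4 + t2 * t3 + t2 * t4 + t3 * t4 = 2 * u ->
    t1 * t2 * t3 + t1 * t2 * t4 + t1 * t3 * t4 + t2 * t3 * t4 = 4 * v ->
  v ^+ 2 + 4 * u ^+ 3 / 27 <= 0.
Proof.
move=> e1 e2 e3.
have [g1 [g2 [g3 [s1 s2 s3]]]] := depressed_cubic_split (algRval u) (algRval v).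
have real g : g ^+ 3 + algRval u * g - algRval v = 0 -> g \is Num.real.
  move=> gE; apply: (@crit_real _ g (algRval t1) (algRval t2) (algRval t3)
    (algRval t4));
    rewrite ?algRvalP //.
  transitivity (4 * g ^+ 3 - 3 * (algRval (t1 + t2 + t3 + t4)) * g ^+ 2
    + 2 * algRval (t1 * t2 + t1 * t3 + t1 * t4 + t2 * t3 + t2 * t4 + t3 * t4) * g
    - algRval (t1 * t2 * t3 + t1 * t2 * t4 + t1 * t3 * t4 + t2 * t3 * t4)).
    by rewrite !(rmorphD, rmorphM) /=; ring.
  rewrite e1 e2 e3 !rmorphM !rmorph_nat rmorph0 mulr0 mul0r subr0.
  by rewrite -[RHS](mulr0 4) -gE; ring.
have gE g : g ^+ 3 + algRval u * g - algRval v = (g - g1) * (g - g2) * (g - g3).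
  rewrite -s2 -s3; have -> : g3 = - g1 - g2 by rewrite -[RHS]addr0 -s1; ring.
  by ring.
have r1 : g1 \is Num.real by apply: real; rewrite gE subrr !mul0r.
have r2 : g2 \is Num.real by apply: real; rewrite gE subrr mulr0 mul0r.
have r3 : g3 \is Num.real by apply: real; rewrite gE subrr mulr0.
rewrite -oppr_ge0 -(pmulr_rge0 _ (_ : 0 < 27)) //.
have -> : 27 * - (v ^+ 2 + 4 * u ^+ 3 / 27) =
  ((in_algR r1 - in_algR r2) * (in_algR r1 - in_algR r3)
   * (in_algR r2 - in_algR r3)) ^+ 2; last exact: sqr_ge0.
have [h1 h2 h3] : [/\ in_algR r1 + in_algR r2 + in_algR r3 = 0,
  in_algR r1 * in_algR r2 + in_algR r1 * in_algR r3 + in_algR r2 * in_algR r3 = u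
  & in_algR r1 * in_algR r2 * in_algR r3 = v].
  by split; apply: algRval_inj.
rewrite -h2 -h3; have -> : in_algR r3 = - in_algR r1 - in_algR r2.
  by rewrite -[RHS]addr0 -h1; ring.
by field.
Qed.

(** The quartic is (y^2 - 2m y + N) (y^2 + 2m y + r), where the first factor has the roots t and
    conj t: m = Re t, N = |t|^2, and N - m^2 = (Im t)^2 is positive. *)
Lemma nonreal_pair (u v c : algR) (t t3 t4 : algC) :
    t \isn't Num.real -> t + t^* + t3 + t4 = 0 ->
    t * t^* + t * t3 + t * t4 + t^* * t3 + t^* * t4 + t3 * t4
      = algRval (2 * u) ->
    t * t^* * t3 + t * t^* * t4 + t * t3 * t4 + t^* * t3 * t4
      = algRval (4 * v) ->
    t * t^* * t3 * t4 = algRval c ->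
  exists m N r : algR, [/\ m ^+ 2 < N, 2 * u = r - 4 * m ^+ 2 + N,
    4 * v = 2 * m * (r - N) & c = N * r].
Proof.
move=> t_nreal e1 e2 e3 e4.
pose m := in_algR (Creal_Re t); pose n := in_algR (Creal_Im t).
pose N := m ^+ 2 + n ^+ 2; pose r := 2 * u + 4 * m ^+ 2 - N.
have n_neq0 : n != 0.
  by apply: contraNneq t_nreal => /(congr1 algRval) n0; apply/Creal_ImP.
have NE : t * t^* = algRval N by rewrite -normCK normC2_Re_Im !rmorphD.
have mE : t + t^* = algRval (2 * m).
  by rewrite rmorphM rmorph_nat /= ReE mulrC divfK // pnatr_eq0.
have t34 : t3 + t4 = - algRval (2 * m).
  by apply/eqP; rewrite -addr_eq0 -mE addrC addrA e1.
have rE : t3 * t4 = algRval r.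
  have -> : t3 * t4 = (t * t^* + t * t3 + t * t4 + t^* * t3 + t^* * t4 + t3 * t4)
    - t * t^* - (t + t^*) * (t3 + t4) by ring.
  rewrite e2 NE mE t34 mulrN opprK -rmorphM -rmorphB -rmorphD; congr algRval.
  by rewrite /r; ring.
exists m, N, r; split.
- by rewrite /N ltrDl exprn_even_gt0.
- by rewrite /r; ring.
- apply: algRval_inj; rewrite -e3.
  transitivity ((t * t^*) * (t3 + t4) + (t + t^*) * (t3 * t4)); first by ring.
  rewrite NE rE mE t34 mulrN -!rmorphM -rmorphN -rmorphD; congr algRval.
  by ring.
- by apply: algRval_inj; rewrite -e4 -mulrA NE rE rmorphM.
Qed.

Lemma conj_quartic_root (C : numClosedFieldType) (b c d z : C) :
    b \is Num.real -> c \is Num.real -> d \is Num.real ->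
    z ^+ 4 + b * z ^+ 2 - c * z + d = 0 ->
  z^* ^+ 4 + b * z^* ^+ 2 - c * z^* + d = 0.
Proof.
move=> /CrealP {2}<- /CrealP {2}<- /CrealP {2}<- zE.
by rewrite -!rmorphXn -!rmorphM -rmorphD -rmorphB -rmorphD zE rmorph0.
Qed.

Section RealRoots.

Variables (u v c g1 g2 g3 : algR).
Hypotheses (g_sum : g1 + g2 + g3 = 0)
  (g_sum2 : g1 * g2 + g1 * g3 + g2 * g3 = u) (g_prod : g1 * g2 * g3 = v)
  (g12 : g1 <= g2) (g23 : g2 <= g3) (f1 : dquartic u v c g1 <= 0)
  (f2 : 0 <= dquartic u v c g2) (f3 : dquartic u v c g3 <= 0).

(** As the coefficients are real, the conjugate of a non-real [t1] is one of the other roots, and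
    the factorization by this pair contradicts the signs at the critical points. *)
Lemma dquartic_root_real (t1 t2 t3 t4 : algC) :
    t1 + t2 + t3 + t4 = 0 ->
    t1 * t2 + t1 * t3 + t1 * t4 + t2 * t3 + t2 * t4 + t3 * t4
      = algRval (2 * u) ->
    t1 * t2 * t3 + t1 * t2 * t4 + t1 * t3 * t4 + t2 * t3 * t4
      = algRval (4 * v) ->
    t1 * t2 * t3 * t4 = algRval c ->
  t1 \is Num.real.
Proof.
move=> e1 e2 e3 e4; apply: contraT => t_nreal.
have pair x y : t1 + t1^* + x + y = 0 ->
    t1 * t1^* + t1 * x + t1 * y + t1^* * x + t1^* * y + x * y
      = algRval (2 * u) ->
    t1 * t1^* * x + t1 * t1^* * y + t1 * x * y + t1^* * x * y
      = algRval (4 * v) ->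
    t1 * t1^* * x * y = algRval c -> False.
  move=> h1 h2 h3 h4.
  have [m [N [r [mN uE vE cE]]]] := nonreal_pair t_nreal h1 h2 h3 h4.
  have := dquartic_crit_sign_split g_sum g_sum2 g_prod g12 g23 uE vE cE f1 f2 f3.
  by rewrite leNgt mN.
have expand z : (z - t1) * (z - t2) * (z - t3) * (z - t4)
    = z ^+ 4 + algRval (2 * u) * z ^+ 2 - algRval (4 * v) * z + algRval c.
  by rewrite -e2 -e3 -e4 -[z ^+ 4]subr0 -(mul0r (z ^+ 3)) -e1; ring.
have : (t1^* - t1) * (t1^* - t2) * (t1^* - t3) * (t1^* - t4) = 0.
  rewrite expand; apply: conj_quartic_root; rewrite ?algRvalP // -expand.
  by rewrite subrr !mul0r.
move/eqP; rewrite !mulf_eq0 !subr_eq0 -CrealE (negPf t_nreal) /= -orbA.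
case/or3P => /eqP tE.
- by case: (pair t3 t4); rewrite tE.
- by case: (pair t2 t4); rewrite tE -?e1 -?e2 -?e3 -?e4; ring.
- by case: (pair t2 t3); rewrite tE -?e1 -?e2 -?e3 -?e4; ring.
Qed.

Lemma dquartic_split_real : exists t1 t2 t3 t4 : algR,
  [/\ t1 + t2 + t3 + t4 = 0,
    t1 * t2 + t1 * t3 + t1 * t4 + t2 * t3 + t2 * t4 + t3 * t4 = 2 * u,
    t1 * t2 * t3 + t1 * t2 * t4 + t1 * t3 * t4 + t2 * t3 * t4 = 4 * v
    & t1 * t2 * t3 * t4 = c].
Proof.
have [t1 [t2 [t3 [t4 [e1 e2 e3 e4]]]]] :=
  depressed_quartic_split (algRval (2 * u)) (algRval (4 * v)) (algRval c).
have r1 := dquartic_root_real e1 e2 e3 e4.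
have r2 : t2 \is Num.real.
  by apply: (@dquartic_root_real t2 t1 t3 t4);
    rewrite -?e1 -?e2 -?e3 -?e4; ring.
have r3 : t3 \is Num.real.
  by apply: (@dquartic_root_real t3 t1 t2 t4);
    rewrite -?e1 -?e2 -?e3 -?e4; ring.
have r4 : t4 \is Num.real.
  by apply: (@dquartic_root_real t4 t1 t2 t3);
    rewrite -?e1 -?e2 -?e3 -?e4; ring.
exists (in_algR r1), (in_algR r2), (in_algR r3), (in_algR r4).
by split; apply: algRval_inj.
Qed.

End RealRoots.

(** * Cardano's formula in the case of three real roots *)

(** With these radicals -(a + b) is Cardano's root of y^3 + u y - v. The left-hand side has the form
    of the elements of S, the right-hand side is [dvalue] at that root. *)
Lemma cardano_value (F : numFieldType) (u v sD a b : F) :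
    u = - 3 * (a * b) -> a ^+ 3 = (- v + sD) / 2 -> b ^+ 3 = (- v - sD) / 2 ->
  - a * (9 * v / 2 + 3 * sD / 2) - b * (9 * v / 2 - 3 * sD / 2) + 2 * u ^+ 2 / 3
  = - u * (- (a + b)) ^+ 2 + 3 * v * - (a + b).
Proof.
move=> -> aE bE.
have -> : v = - (a ^+ 3 + b ^+ 3) by rewrite aE bE; field.
have -> : sD = a ^+ 3 - b ^+ 3 by rewrite aE bE; field.
by field.
Qed.

Lemma cube_root_unity (C : numClosedFieldType) (z : C) :
  3.-primitive_root z -> [/\ z ^+ 2 = - 1 - z, z^-1 = z ^+ 2 & z^* = z ^+ 2].
Proof.
move=> zP; have z3 := prim_expr_order zP.
have z1 : z != 1 by rewrite -(prim_order_dvd zP 1) // -[z]expr1.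
have z0 : z != 0 by apply: contra_eq_neq z3 => ->; rewrite expr0n eq_sym oner_eq0.
have zV : z^-1 = z ^+ 2 by rewrite -[LHS]mul1r -z3 exprS mulrC mulKf.
split=> //.
  apply/eqP; rewrite -subr_eq0; have : (z - 1) * (z ^+ 2 - (- 1 - z)) = 0.
    by transitivity (z ^+ 3 - 1); [ring | rewrite z3 subrr].
  by move/eqP; rewrite mulf_eq0 [z - 1 == 0]subr_eq0 (negPf z1).
have zn : `|z| = 1.
  by apply/eqP; rewrite -(@eqrXn2 _ 3) ?ler01 // -normrX z3 normr1 expr1n.
by rewrite -zV invC_norm zn expr1n invr1 mul1r.
Qed.

Section Cardano.

Variables (u v : algR) (zeta sD omega : algC).
Hypotheses (zetaP : 3.-primitive_root zeta)
  (sDE : sD ^+ 2 = algRval (v ^+ 2 + 4 * u ^+ 3 / 27))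
  (omegaE : omega ^+ 3 = (- algRval v + sD) / 2)
  (disc_npos : v ^+ 2 + 4 * u ^+ 3 / 27 <= 0).

(** The square of [sD] is a nonpositive real, so [sD] is purely imaginary. Conjugation therefore
    exchanges the radicands (-v + sD)/2 and (-v - sD)/2. *)
Let conj_sD : sD^* = - sD.
Proof.
have : sD^* ^+ 2 == sD ^+ 2.
  by rewrite -rmorphXn sDE; apply/eqP/CrealP/algRvalP.
rewrite eqf_sqr => /orP[/eqP sDr|/eqP//].
have : 0 <= sD ^+ 2 by rewrite real_exprn_even_ge0 // CrealE sDr.
rewrite sDE -(rmorph0 algRval) -algR_leE => d0.
have d00 : v ^+ 2 + 4 * u ^+ 3 / 27 = 0 by apply/eqP; rewrite eq_le disc_npos d0.
move: sDE; rewrite d00 rmorph0 => /eqP; rewrite sqrf_eq0 => /eqP ->.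
by rewrite rmorph0 oppr0.
Qed.

Let conj_omega3 : omega^* ^+ 3 = (- algRval v - sD) / 2.
Proof.
rewrite -rmorphXn omegaE rmorphM fmorphV rmorph_nat rmorphD rmorphN /= conj_sD.
by rewrite (CrealP (algRvalP v)).
Qed.

(** Cardano's radicals must satisfy 3ab = -u. Here |omega|^2 and -u/3 are nonnegative reals with the
    same cube -u^3/27, so they agree whichever cube root [omega] is. *)
Let omega_norm : algRval u = - 3 * (omega * omega^*).
Proof.
have u3_le0 : u ^+ 3 <= 0.
  by move: disc_npos; have := sqr_ge0 v; lra.
have u_le0 : u <= 0 by rewrite -(@exprn_odd_le0 _ 3).
have n0 : 0 <= algRval (- u / 3).
  by rewrite -(rmorph0 algRval) -algR_leE; lra.
suff -> : omega * omega^* = algRval (- u / 3).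
  by rewrite -(rmorph_nat algRval 3) -rmorphN -rmorphM; congr algRval; field.
rewrite -normCK; apply/eqP; rewrite -(@eqrXn2 _ 3) //; last by rewrite exprn_ge0.
rewrite normCK exprMn conj_omega3 omegaE; apply/eqP.
transitivity ((algRval v ^+ 2 - sD ^+ 2) / 4); first by field.
rewrite sDE -!rmorphXn -rmorphB -(rmorph_nat algRval 4) -fmorphV -rmorphM.
by congr algRval; field.
Qed.

(** For z = zeta^k these are Cardano's three roots of y^3 + u y - v; they are real because
    conjugation swaps the two summands. *)
Let crit (z : algC) := - (z * omega + z^-1 * omega^*).

Let crit_conj_real (z : algC) : z^* = z^-1 -> crit z \is Num.real.
Proof.
move=> zV; rewrite CrealE /crit -zV rmorphN rmorphD !rmorphM /= !conjCK.
by rewrite addrC.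
Qed.

Definition Svalue (k : nat) : algC :=
  - zeta ^+ k * omega * (9 * algRval v / 2 + 3 * sD / 2)
  - zeta ^- k * omega^* * (9 * algRval v / 2 - 3 * sD / 2)
  + 2 * algRval u ^+ 2 / 3.

Let SvalueE k : Svalue k =
  - algRval u * crit (zeta ^+ k) ^+ 2 + 3 * algRval v * crit (zeta ^+ k).
Proof.
have zk3 : (zeta ^+ k) ^+ 3 = 1.
  by rewrite -exprM mulnC exprM (prim_expr_order zetaP) expr1n.
have zk0 : zeta ^+ k != 0.
  by apply: contra_eq_neq zk3 => ->; rewrite expr0n eq_sym oner_eq0.
rewrite /Svalue /crit mulNr; apply: cardano_value.
- by rewrite omega_norm mulrACA divff // mul1r.
- by rewrite exprMn zk3 mul1r omegaE.
- by rewrite exprMn exprVn zk3 invr1 mul1r conj_omega3.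
Qed.

Lemma cardano : exists g0 g1 g2 : algR,
  [/\ g0 + g1 + g2 = 0, g0 * g1 + g0 * g2 + g1 * g2 = u, g0 * g1 * g2 = v
    & [seq Svalue k | k <- iota 0 3]
      = [seq algRval (dvalue u v g) | g <- [:: g0; g1; g2]]].
Proof.
have [z2 zV zc] := cube_root_unity zetaP.
have zkc k : (zeta ^+ k)^* = (zeta ^+ k)^-1 by rewrite rmorphXn /= zc -zV exprVn.
exists (in_algR (crit_conj_real (zkc 0))), (in_algR (crit_conj_real (zkc 1))).
exists (in_algR (crit_conj_real (zkc 2))).
have c0 : crit (zeta ^+ 0) = - (omega + omega^*).
  by rewrite /crit expr0 invr1 !mul1r.
have c1 : crit (zeta ^+ 1) = - (zeta * omega - (1 + zeta) * omega^*).
  by rewrite /crit expr1 zV z2; ring.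
have c2 : crit (zeta ^+ 2) = - (zeta * omega^* - (1 + zeta) * omega).
  by rewrite /crit -zV invrK zV z2; ring.
have z0 : zeta ^+ 2 + zeta + 1 = 0 by rewrite z2; ring.
have omega3 : omega ^+ 3 + omega^* ^+ 3 = - algRval v.
  by rewrite omegaE conj_omega3; field.
split.
- by apply: algRval_inj; rewrite !rmorphD rmorph0 /= c0 c1 c2; ring.
- apply: algRval_inj; rewrite !rmorphD !rmorphM /= c0 c1 c2 omega_norm.
  move: (omega^*) => b; rewrite -[RHS]addr0.
  (* The relation zeta^2 + zeta + 1 = 0 enters [ring] through an explicit cofactor, the quotient by
     it of the difference of the two sides. *)
  by rewrite -(mul0r (2 * omega * b - omega ^+ 2 - b ^+ 2)) -z0; ring.
- apply: algRval_inj; rewrite !rmorphM /= c0 c1 c2.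
  rewrite -[RHS]opprK -omega3; move: (omega^*) => b; rewrite -[RHS]addr0.
  by rewrite -(mul0r ((omega + b) * (omega - b) ^+ 2)) -z0; ring.
have valE g : algRval (dvalue u v g)
    = - algRval u * algRval g ^+ 2 + 3 * algRval v * algRval g.
  by rewrite /dvalue !(rmorphD, rmorphN, rmorphM, rmorphXn, rmorph_nat).
by rewrite [LHS]/= !SvalueE 3!map_cons !valE.
Qed.

End Cardano.

(** * Ordering the critical points and the critical values *)

(** Since [s2] is least, it is theta_1, and theta_2 is the smaller of the other two; lying below
    theta_2 is lying below both, whichever is larger. *)
Lemma sort3P (x0 x1 x2 s1 s2 s3 c : algR) (S := sort <=%O [:: x0; x1; x2]) :
    perm_eq [:: x0; x1; x2] [:: s1; s2; s3] -> s2 <= s1 -> s2 <= s3 ->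
  nth 0 S 0 <= c /\ c <= nth 0 S 1 <-> [/\ s2 <= c, c <= s1 & c <= s3].
Proof.
move=> pE s21 s23; rewrite {}/S.
have -> : sort <=%O [:: x0; x1; x2] = sort <=%O [:: s1; s2; s3].
  exact/(perm_sortP le_total le_trans le_anti).
have [s13|/ltW s31] := leP s1 s3.
  have -> : sort <=%O [:: s1; s2; s3] = sort <=%O [:: s2; s1; s3].
    apply/(perm_sortP le_total le_trans le_anti).
    exact/permPl/(perm_catCA [:: s1] [:: s2] [:: s3]).
  rewrite (sorted_sort le_trans) /= ?s21 ?s13 //.
  split=> [[c2 c1]|[]] //; split=> //; exact: le_trans s13.
have -> : sort <=%O [:: s1; s2; s3] = sort <=%O [:: s2; s3; s1].
  apply/(perm_sortP le_total le_trans le_anti).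
  exact/permPl/(perm_catC [:: s1] [:: s2; s3]).
rewrite (sorted_sort le_trans) /= ?s23 ?s31 //.
split=> [[c2 c1]|[]] //; split=> //; exact: le_trans s31.
Qed.

Lemma sorted_triple (s1 s2 s3 : algR) : exists t1 t2 t3,
  [/\ t1 <= t2, t2 <= t3 & perm_eq [:: s1; s2; s3] [:: t1; t2; t3]].
Proof.
have : sorted <=%O (sort <=%O [:: s1; s2; s3]) by exact/sort_sorted/le_total.
have : perm_eq [:: s1; s2; s3] (sort <=%O [:: s1; s2; s3]).
  by rewrite perm_sym perm_sort.
case: (sort _ _) (size_sort <=%O [:: s1; s2; s3]) => [|t1 [|t2 [|t3 []]]] // _.
by move=> p /= /and3P[? ? _]; exists t1, t2, t3.
Qed.

(** Permuted roots give the same monic cubic. This allows the critical points to be sorted although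
    Cardano's formula lists them in no particular order. *)
Lemma perm3_esym (R : comNzRingType) (s1 s2 s3 t1 t2 t3 : R) :
    perm_eq [:: s1; s2; s3] [:: t1; t2; t3] ->
  [/\ s1 + s2 + s3 = t1 + t2 + t3,
    s1 * s2 + s1 * s3 + s2 * s3 = t1 * t2 + t1 * t3 + t2 * t3
    & s1 * s2 * s3 = t1 * t2 * t3].
Proof.
move=> p; have prodE (a b c : R) : \prod_(x <- [:: a; b; c]) ('X - x%:P)
    = 'X^3 - (a + b + c)%:P * 'X^2 + (a * b + a * c + b * c)%:P * 'X
      - (a * b * c)%:P.
  by rewrite !big_cons big_nil !(polyCD, polyCM); ring.
have := perm_big _ p (op := *%R) (P := xpredT) (F := fun x : R => 'X - x%:P).
move=> /(_ 1); rewrite !prodE => E.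
split.
- have := congr1 (fun p : {poly R} => p`_2) E.
  rewrite !(coefD, coefN, coefCM, coefXn, coefX, coefC) /=.
  by rewrite !(mulr0, mulr1, add0r, addr0, oppr0) => /oppr_inj.
- have := congr1 (fun p : {poly R} => p`_1) E.
  rewrite !(coefD, coefN, coefCM, coefXn, coefX, coefC) /=.
  by rewrite !(mulr0, mulr1, add0r, addr0, oppr0).
- have := congr1 (fun p : {poly R} => p`_0) E.
  rewrite !(coefD, coefN, coefCM, coefXn, coefX, coefC) /=.
  by rewrite !(mulr0, mulr1, add0r, addr0, oppr0) => /oppr_inj.
Qed.

(** * The coefficient bounds in terms of the traces *)

Section RealConditions.

Variables (R : realFieldType) (s a1 a2 a3 a4 : R).

Definition ru2 : R := - (3 * a1 ^+ 2) / 16 + a2 / 2 - 2 * s ^+ 2.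
Definition ru3 : R :=
  - a1 ^+ 3 / 32 + a1 * a2 / 8 + a1 * s ^+ 2 / 4 - a3 / 4.
Definition rfconst : R :=
  3 / 256 * a1 ^+ 4 - 1 / 16 * a1 ^+ 2 * a2 - 1 / 2 * s ^+ 2 * a1 ^+ 2
  + 1 / 4 * a1 * a3 + 2 * s ^+ 2 * a2 - 2 * (s ^+ 2) ^+ 2.

(** The traces sum to -a1, so the shift by a1/4 removes the cubic term. The quantities u_2, u_3 and
    a4 - [fconst] are what the remaining coefficients become, up to the factors 2 and -4. *)
Lemma trace_roots_depress x1 x2 x3 x4 (t1 := x1 + a1 / 4) (t2 := x2 + a1 / 4)
    (t3 := x3 + a1 / 4) (t4 := x4 + a1 / 4) :
  trace_roots s a1 a2 a3 a4 x1 x2 x3 x4 <->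
  [/\ t1 + t2 + t3 + t4 = 0,
    t1 * t2 + t1 * t3 + t1 * t4 + t2 * t3 + t2 * t4 + t3 * t4 = 2 * ru2,
    t1 * t2 * t3 + t1 * t2 * t4 + t1 * t3 * t4 + t2 * t3 * t4 = 4 * ru3
    & t1 * t2 * t3 * t4 = a4 - rfconst].
Proof.
rewrite /t1 /t2 /t3 /t4 /ru2 /ru3 /rfconst; split.
  by move=> [-> -> -> ->]; split; field.
move=> [e1 e2 e3 e4].
have a1E : a1 = - (x1 + x2 + x3 + x4).
  by rewrite -[LHS]subr0 -e1; field.
have a2E : a2 = x1 * x2 + x1 * x3 + x1 * x4 + x2 * x3 + x2 * x4 + x3 * x4
    + 4 * s ^+ 2.
  have -> : a2 = 2 * (- (3 * a1 ^+ 2) / 16 + a2 / 2 - 2 * s ^+ 2)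
    + 3 / 8 * a1 ^+ 2 + 4 * s ^+ 2 by field.
  by rewrite -e2 a1E; field.
have a3E : a3 = - (x1 * x2 * x3 + x1 * x2 * x4 + x1 * x3 * x4 + x2 * x3 * x4)
    - 3 * s ^+ 2 * (x1 + x2 + x3 + x4).
  have -> : a3 = - (4 * (- a1 ^+ 3 / 32 + a1 * a2 / 8 + a1 * s ^+ 2 / 4 - a3 / 4))
    - a1 ^+ 3 / 8 + a1 * a2 / 2 + a1 * s ^+ 2 by field.
  by rewrite -e3 a2E a1E; field.
split=> //.
by rewrite -[LHS](subrK rfconst) /rfconst -e4 a3E a2E a1E; field.
Qed.

(** This is h(X) replaced by h(-X). It carries statements about the gaps 2s - x_i over to the gaps
    2s + x_i. *)
Lemma trace_roots_opp x1 x2 x3 x4 : trace_roots s a1 a2 a3 a4 x1 x2 x3 x4 ->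
  trace_roots s (- a1) a2 (- a3) a4 (- x1) (- x2) (- x3) (- x4).
Proof. by move=> [-> -> -> ->]; split; ring. Qed.

(* The left-hand sides are, up to factorials, the derivatives of
   [prod_i (X - x_i)] at [2 s]. *)
Lemma trace_roots_gap x1 x2 x3 x4 (d1 := 2 * s - x1) (d2 := 2 * s - x2)
    (d3 := 2 * s - x3) (d4 := 2 * s - x4) :
    trace_roots s a1 a2 a3 a4 x1 x2 x3 x4 ->
  [/\ d1 + d2 + d3 + d4 = 8 * s + a1,
    d1 * d2 + d1 * d3 + d1 * d4 + d2 * d3 + d2 * d4 + d3 * d4
      = a2 + 20 * s ^+ 2 + 6 * s * a1,
    d1 * d2 * d3 + d1 * d2 * d4 + d1 * d3 * d4 + d2 * d3 * d4
      = a3 + 9 * s ^+ 2 * a1 + 4 * s * a2 + 16 * s ^+ 2 * s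
    & d1 * d2 * d3 * d4 = a4 + 2 * s ^+ 2 * a2 + 2 * (s ^+ 2) ^+ 2
        + 2 * s * (s ^+ 2 * a1 + a3)].
Proof. by rewrite /d1 /d2 /d3 /d4 => -[-> -> -> ->]; split; ring. Qed.

Definition bound_conds : Prop :=
  [/\ `|a1| <= 8 * s, 6 * s * `|a1| - 20 * s ^+ 2 <= a2,
    - 9 * s ^+ 2 * a1 - 4 * s * a2 - 16 * s ^+ 2 * s <= a3,
    a3 <= - 9 * s ^+ 2 * a1 + 4 * s * a2 + 16 * s ^+ 2 * s
    & 2 * s * `|s ^+ 2 * a1 + a3| - 2 * s ^+ 2 * a2 - 2 * (s ^+ 2) ^+ 2 <= a4].

Definition bound_equalities : Prop :=
  `|a1| = 8 * s \/ 6 * s * `|a1| - 20 * s ^+ 2 = a2 \/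
  - 9 * s ^+ 2 * a1 - 4 * s * a2 - 16 * s ^+ 2 * s = a3 \/
  a3 = - 9 * s ^+ 2 * a1 + 4 * s * a2 + 16 * s ^+ 2 * s \/
  2 * s * `|s ^+ 2 * a1 + a3| - 2 * s ^+ 2 * a2 - 2 * (s ^+ 2) ^+ 2 = a4.

End RealConditions.

Lemma mulr_norm_le (R : realFieldType) (k a b : R) : 0 <= k ->
  (k * `|a| <= b) = (k * a <= b) && (- (k * a) <= b).
Proof.
by move=> k0; rewrite -{1}(ger0_norm k0) -normrM ler_norml andbC [- b <= _]lerNl.
Qed.

Lemma esym4_ge0_inv (R : realFieldType) (x y z t : R) :
    0 <= x + y + z + t ->
    0 <= x * y + x * z + x * t + y * z + y * t + z * t ->
    0 <= x * y * z + x * y * t + x * z * t + y * z * t -> 0 <= x * y * z * t ->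
  [/\ 0 <= x, 0 <= y, 0 <= z & 0 <= t].
Proof.
move=> e1 e2 e3 e4; split; first exact: (ge0_of_esym4 e1 e2 e3 e4).
- apply: (@ge0_of_esym4 _ y x z t).
  + by rewrite (_ : y + x + z + t = x + y + z + t) //; ring.
  + by rewrite (_ : _ + _ = x * y + x * z + x * t + y * z + y * t + z * t) //; ring.
  + by rewrite (_ : _ + _ = x * y * z + x * y * t + x * z * t + y * z * t) //; ring.
  + by rewrite (_ : _ * _ = x * y * z * t) //; ring.
- apply: (@ge0_of_esym4 _ z x y t).
  + by rewrite (_ : _ + _ = x + y + z + t) //; ring.
  + by rewrite (_ : _ + _ = x * y + x * z + x * t + y * z + y * t + z * t) //; ring.
  + by rewrite (_ : _ + _ = x * y * z + x * y * t + x * z * t + y * z * t) //; ring.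
  + by rewrite (_ : _ * _ = x * y * z * t) //; ring.
- apply: (@ge0_of_esym4 _ t x y z).
  + by rewrite (_ : _ + _ = x + y + z + t) //; ring.
  + by rewrite (_ : _ + _ = x * y + x * z + x * t + y * z + y * t + z * t) //; ring.
  + by rewrite (_ : _ + _ = x * y * z + x * y * t + x * z * t + y * z * t) //; ring.
  + by rewrite (_ : _ * _ = x * y * z * t) //; ring.
Qed.

Lemma in_ball4 (R : realFieldType) (b x1 x2 x3 x4 : R) :
  {in [:: x1; x2; x3; x4], forall x, - b <= x <= b} <->
  [/\ 0 <= b - x1, 0 <= b - x2, 0 <= b - x3 & 0 <= b - x4] /\
  [/\ 0 <= b - - x1, 0 <= b - - x2, 0 <= b - - x3 & 0 <= b - - x4].
Proof.
rewrite !subr_ge0; split=> [xB|[[p1 p2 p3 p4] [n1 n2 n3 n4]] x].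
  have B x : x \in [:: x1; x2; x3; x4] -> x <= b /\ - x <= b.
    by move=> /xB/andP[? ?]; rewrite lerNl.
  have [? ?] : x1 <= b /\ - x1 <= b by apply: B; rewrite !inE eqxx.
  have [? ?] : x2 <= b /\ - x2 <= b by apply: B; rewrite !inE eqxx orbT.
  have [? ?] : x3 <= b /\ - x3 <= b by apply: B; rewrite !inE eqxx !orbT.
  by have [] : x4 <= b /\ - x4 <= b by apply: B; rewrite !inE eqxx !orbT.
by rewrite lerNl !inE => /or4P[] /eqP ->; apply/andP.
Qed.

Lemma bound_condsE (R : realFieldType) (s a1 a2 a3 a4 : R) : 0 <= s ->
  bound_conds s a1 a2 a3 a4 <->
  [/\ 0 <= 8 * s + a1, 0 <= a2 + 20 * s ^+ 2 + 6 * s * a1,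
    0 <= a3 + 9 * s ^+ 2 * a1 + 4 * s * a2 + 16 * s ^+ 2 * s &
    0 <= a4 + 2 * s ^+ 2 * a2 + 2 * (s ^+ 2) ^+ 2 + 2 * s * (s ^+ 2 * a1 + a3)] /\
  [/\ 0 <= 8 * s - a1, 0 <= a2 + 20 * s ^+ 2 + 6 * s * - a1,
    0 <= - a3 + 9 * s ^+ 2 * - a1 + 4 * s * a2 + 16 * s ^+ 2 * s &
    0 <= a4 + 2 * s ^+ 2 * a2 + 2 * (s ^+ 2) ^+ 2
         + 2 * s * (s ^+ 2 * - a1 - a3)].
Proof.
move=> s0; rewrite /bound_conds ler_norml !lerBlDr !mulr_norm_le ?mulr_ge0 //.
have -> : 2 * s * (s ^+ 2 * - a1 - a3) = - (2 * s * (s ^+ 2 * a1 + a3)) by ring.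
move: (2 * s * (s ^+ 2 * a1 + a3)) => e.
split=> [[/andP[? ?] /andP[? ?] ? ? /andP[? ?]]|[[? ? ? ?] [? ? ? ?]]].
  split; split; lra.
by split; try (apply/andP; split); lra.
Qed.

Lemma bound_condsP (R : realFieldType) (s a1 a2 a3 a4 x1 x2 x3 x4 : R) :
    0 <= s -> trace_roots s a1 a2 a3 a4 x1 x2 x3 x4 ->
  {in [:: x1; x2; x3; x4], forall x, - (2 * s) <= x <= 2 * s}
  <-> bound_conds s a1 a2 a3 a4.
Proof.
move=> s0 tr; rewrite bound_condsE // in_ball4.
have [<- <- <- <-] := trace_roots_gap tr.
have [<- <- <- <-] := trace_roots_gap (trace_roots_opp tr).
split=> [[[? ? ? ?] [? ? ? ?]]|[[d1 d2 d3 d4] [k1 k2 k3 k4]]].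
  by split; apply: esym4_ge0.
by split; apply: esym4_ge0_inv.
Qed.

(** A vanishing gap makes one of the two products of gaps zero, which is equality in the last bound.
    Any other equality leads back to this one by [esym4_eq0]. *)
Lemma bound_equalitiesP (R : realFieldType) (s a1 a2 a3 a4 x1 x2 x3 x4 : R) :
    0 <= s -> trace_roots s a1 a2 a3 a4 x1 x2 x3 x4 ->
    {in [:: x1; x2; x3; x4], forall x, - (2 * s) <= x <= 2 * s} ->
  (exists2 x, x \in [:: x1; x2; x3; x4] & x ^+ 2 = (2 * s) ^+ 2)
  <-> bound_equalities s a1 a2 a3 a4.
Proof.
move=> s0 tr xsB; have [g1 g2 g3 g4] := trace_roots_gap tr.
have [h1 h2 h3 h4] := trace_roots_gap (trace_roots_opp tr).
have [[p1 p2 p3 p4] [n1 n2 n3 n4]] := (in_ball4 _ _ _ _ _).1 xsB.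
have z0 : (exists2 x, x \in [:: x1; x2; x3; x4] & x ^+ 2 = (2 * s) ^+ 2) <->
    (2 * s - x1) * (2 * s - x2) * (2 * s - x3) * (2 * s - x4) = 0 \/
    (2 * s - - x1) * (2 * s - - x2) * (2 * s - - x3) * (2 * s - - x4) = 0.
  split.
    move=> [x xs /eqP]; rewrite eqf_sqr => /orP[] /eqP xE; [left|right]; apply/eqP;
    by move: xs; rewrite !inE !mulf_eq0 => /or4P[] /eqP <-;
      rewrite xE ?opprK subrr eqxx ?orbT.
  case=> /eqP; rewrite !mulf_eq0 -!orbA => /or4P[] /eqP xE.
  - by exists x1; rewrite ?inE ?eqxx //; congr (_ ^+ 2); lra.
  - by exists x2; rewrite ?inE ?eqxx ?orbT //; congr (_ ^+ 2); lra.
  - by exists x3; rewrite ?inE ?eqxx ?orbT //; congr (_ ^+ 2); lra.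
  - by exists x4; rewrite ?inE ?eqxx ?orbT //; congr (_ ^+ 2); lra.
  - by exists x1; rewrite ?inE ?eqxx //; rewrite -sqrrN; congr (_ ^+ 2); lra.
  - by exists x2; rewrite ?inE ?eqxx ?orbT //; rewrite -sqrrN; congr (_ ^+ 2); lra.
  - by exists x3; rewrite ?inE ?eqxx ?orbT //; rewrite -sqrrN; congr (_ ^+ 2); lra.
  - by exists x4; rewrite ?inE ?eqxx ?orbT //; rewrite -sqrrN; congr (_ ^+ 2); lra.
rewrite z0.
have normE k a : 0 <= k -> k * `|a| = `|k * a|.
  by move=> k0; rewrite normrM ger0_norm.
have s60 : 0 <= 6 * s by rewrite mulr_ge0.
have s20 : 0 <= 2 * s by rewrite mulr_ge0.
have [_ _ _ P0] := esym4_ge0 p1 p2 p3 p4; have [_ _ _ N0] := esym4_ge0 n1 n2 n3 n4.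
split.
  (* The two products of gaps are b + t and b - t with the same b and t, both nonnegative; if one of
     them is zero, then b = |t|. *)
  move=> E; do 4 right; rewrite normE //; move: E P0 N0; rewrite g4 h4 => E P0 N0.
  by case: (ger0P (2 * s * (s ^+ 2 * a1 + a3))) => ?; case: E => ?; lra.
move=> E.
have [PE|NE] : [\/ 8 * s + a1 = 0, a2 + 20 * s ^+ 2 + 6 * s * a1 = 0,
      a3 + 9 * s ^+ 2 * a1 + 4 * s * a2 + 16 * s ^+ 2 * s = 0 |
      a4 + 2 * s ^+ 2 * a2 + 2 * (s ^+ 2) ^+ 2 + 2 * s * (s ^+ 2 * a1 + a3) = 0] \/
    [\/ 8 * s - a1 = 0, a2 + 20 * s ^+ 2 + 6 * s * - a1 = 0,
      - a3 + 9 * s ^+ 2 * - a1 + 4 * s * a2 + 16 * s ^+ 2 * s = 0 |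
      a4 + 2 * s ^+ 2 * a2 + 2 * (s ^+ 2) ^+ 2
         + 2 * s * (s ^+ 2 * - a1 - a3) = 0].
- move: E; rewrite /bound_equalities !normE // => -[|[|[|[]]]].
  + by case: (ger0P a1) => ? ?; [right|left]; apply: Or41; lra.
  + by case: (ger0P (6 * s * a1)) => ? ?; [right|left]; apply: Or42; lra.
  + by move=> ?; left; apply: Or43; lra.
  + by move=> ?; right; apply: Or43; lra.
  + by case: (ger0P (2 * s * (s ^+ 2 * a1 + a3))) => ? ?; [right|left];
      apply: Or44; lra.
- by left; apply: esym4_eq0 => //; rewrite g1 g2 g3 g4.
- by right; apply: esym4_eq0 => //; rewrite h1 h2 h3 h4.
Qed.

(** * Transfer of the conditions between [algR] and [algC] *)

Lemma algRval_norm (x : algR) : algRval `|x| = `|algRval x|. Proof. by []. Qed.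

(* Rewriting with [rmorphM algRval] and its siblings leaves [algRval] wrapped in
   its ring morphism structure. *)
Lemma algRmorph_norm (x : algR) :
  (algRval : {rmorphism algR -> algC}) `|x|
  = `|(algRval : {rmorphism algR -> algC}) x|.
Proof. by []. Qed.

Definition algRvalE := (rmorph_nat algRval, rmorph_int algRval, rmorph1 algRval,
  rmorphXn algRval, fmorphV algRval, rmorphN algRval, rmorphM algRval,
  rmorphD algRval, algRval_norm, algRmorph_norm).

Lemma algR_eqE (x y : algR) : (x = y) <-> (algRval x = algRval y).
Proof. by split=> [->|/algRval_inj]. Qed.

Section Transfer.

Variables (q : nat) (a1 a2 a3 a4 : int).
Local Notation s := (rsqrt q).
Local Notation b1 := (a1%:~R : algR).
Local Notation b2 := (a2%:~R : algR).
Local Notation b3 := (a3%:~R : algR).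
Local Notation b4 := (a4%:~R : algR).
Local Notation u := (ru2 s b1 b2).
Local Notation v := (ru3 s b1 b2 b3).
Local Notation disc := (v ^+ 2 + 4 * u ^+ 3 / 27).

Lemma bound_conds_algC : bound_conds s b1 b2 b3 b4 <->
  [/\ cond_a q a1, cond_bs q a1 a2, cond_c q a1 a2 a3 & cond_e q a1 a2 a3 a4].
Proof.
rewrite /bound_conds rsqrtK !algR_leE !algRvalE.
by split=> [[? ? ? ? ?]|[? ? [? ?] ?]]; split.
Qed.

Lemma bound_equalities_algC : bound_equalities s b1 b2 b3 b4 <->
  (`|(a1%:~R : algC)| = 8 * sqrtC q%:R
        \/ 6 * sqrtC q%:R * `|(a1%:~R : algC)| - 20 * q%:R = a2%:~R
        \/ - 9 * q%:R * a1%:~R - 4 * sqrtC q%:R * a2%:~R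
             - 16 * q%:R * sqrtC q%:R = (a3%:~R : algC)
        \/ (a3%:~R : algC) = - 9 * q%:R * a1%:~R + 4 * sqrtC q%:R * a2%:~R
             + 16 * q%:R * sqrtC q%:R
        \/ 2 * sqrtC q%:R * `|q%:R * a1%:~R + a3%:~R| - 2 * q%:R * a2%:~R
             - 2 * (q%:R : algC) ^+ 2 = a4%:~R).
Proof. by rewrite /bound_equalities rsqrtK !algR_eqE !algRvalE. Qed.

Lemma u2_algC : u2 q a1 a2 = algRval u.
Proof. by rewrite /ru2 rsqrtK !algRvalE. Qed.

Lemma u3_algC : u3 q a1 a2 a3 = algRval v.
Proof. by rewrite /ru3 rsqrtK !algRvalE. Qed.

Lemma Delta_algC : Delta q a1 a2 a3 = algRval disc.
Proof. by rewrite /Delta u2_algC u3_algC !algRvalE. Qed.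

Lemma fconst_algC : fconst q a1 a2 a3 = algRval (rfconst s b1 b2 b3).
Proof. by rewrite /rfconst rsqrtK !algRvalE. Qed.

Lemma cond_b_algC : cond_b q a1 a2 <-> u <= 0.
Proof.
have -> : (u <= 0) = (b2 <= 3 / 8 * b1 ^+ 2 + 4 * s ^+ 2).
  by rewrite /ru2; apply/idP/idP; lra.
by rewrite rsqrtK algR_leE !algRvalE.
Qed.

(** The radicand in (d) is -48u and the midpoint minus a3 is 4v. With w = sqrt(-48u), (d) reads |v|
    <= w^3/864, where 864 = 4 * 216, and squaring gives v^2 <= -4 u^3 / 27 since 48^3 / 864^2 =
    4/27. A nonpositive discriminant forces u <= 0, which is (b). *)
Lemma cond_bd_algC : cond_b q a1 a2 /\ cond_d q a1 a2 a3 <-> disc <= 0.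
Proof.
rewrite cond_b_algC.
suff dE : u <= 0 -> cond_d q a1 a2 a3 <-> disc <= 0.
  split=> [[u0 /(dE u0)]//|d0]; suff u0 : u <= 0 by split=> //; apply/dE.
  rewrite -(@exprn_odd_le0 _ 3) //.
  by move: d0; have := sqr_ge0 v; lra.
move=> u0.
have w_real : sqrtC (algRval (- 48 * u)) \is Num.real.
  by rewrite ger0_real // sqrtC_ge0 -(rmorph0 algRval) -algR_leE; lra.
pose w := in_algR w_real.
have w0 : 0 <= w.
  by rewrite algR_leE rmorph0 sqrtC_ge0 -(rmorph0 algRval) -algR_leE; lra.
have wE : w ^+ 2 = - 48 * u.
  by apply: algRval_inj; rewrite rmorphXn /= sqrtCK.
have pE : pow32 q a1 a2 = algRval (w ^+ 3).
  have radE : 9 * a1%:~R ^+ 2 - 24 * a2%:~R + 96 * q%:R = algRval (- 48 * u).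
    transitivity (algRval (9 * b1 ^+ 2 - 24 * b2 + 96 * s ^+ 2)).
      by rewrite rsqrtK !algRvalE.
    by congr algRval; rewrite /ru2; field.
  by rewrite /pow32 radE rmorphXn.
pose d := 1 / 2 * b1 * b2 - 1 / 8 * b1 ^+ 3 + s ^+ 2 * b1.
have mE : dmid q a1 a2 = algRval d by rewrite /d rsqrtK !algRvalE.
have -> : cond_d q a1 a2 a3 <->
    d - 1 / 216 * w ^+ 3 <= b3 /\ b3 <= d + 1 / 216 * w ^+ 3.
  rewrite /cond_d mE pE !algR_leE !(rmorphD algRval, rmorphN algRval).
  by rewrite !(rmorphM algRval (1 / 216)) !algRvalE.
have -> : d - 1 / 216 * w ^+ 3 <= b3 /\ b3 <= d + 1 / 216 * w ^+ 3 <->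
    `|v| <= w ^+ 3 / 864.
  have vE : v = (d - b3) / 4 by rewrite /ru3 /d; field.
  rewrite ler_norml; split=> [[? ?]|/andP[]]; first by apply/andP; split; lra.
  by split; lra.
have w30 : 0 <= w ^+ 3 / 864 by rewrite divr_ge0 ?exprn_ge0.
rewrite -(@ler_pXn2r _ 2) // ?nnegrE // real_normK ?num_real //.
have -> : (w ^+ 3 / 864) ^+ 2 = - (4 * u ^+ 3 / 27).
  transitivity ((w ^+ 2) ^+ 3 / 864 ^+ 2); first by field.
  by rewrite wE; field.
by rewrite -subr_le0 opprK.
Qed.

Lemma trace_roots_disc x1 x2 x3 x4 :
  trace_roots s b1 b2 b3 b4 x1 x2 x3 x4 -> disc <= 0.
Proof. by move=> /trace_roots_depress[e1 e2 e3 _]; exact: disc_le0 e1 e2 e3. Qed.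

Section Thetas.

Variables zeta sD omega : algC.
Hypotheses (zetaP : 3.-primitive_root zeta) (sDE : sD ^+ 2 = Delta q a1 a2 a3)
  (omegaE : omega ^+ 3 = (- u3 q a1 a2 a3 + sD) / 2) (disc0 : disc <= 0).

Lemma Sseq_cardano : exists g0 g1 g2 : algR,
  [/\ g0 + g1 + g2 = 0, g0 * g1 + g0 * g2 + g1 * g2 = u, g0 * g1 * g2 = v
    & Sseq q a1 a2 a3 zeta sD omega
      = [seq algRval (dvalue u v g) | g <- [:: g0; g1; g2]]].
Proof.
have hD := sDE; have hO := omegaE; rewrite Delta_algC in hD; rewrite u3_algC in hO.
have [g0 [g1 [g2 [s1 s2 s3 SE]]]] := cardano zetaP hD hO disc0.
exists g0, g1, g2; split=> //; rewrite -SE.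
by rewrite /Sseq /Selt u2_algC u3_algC.
Qed.

Lemma cond_f_algC : cond_f q a1 a2 a3 a4 zeta sD omega <->
  exists x1 x2 x3 x4 : algR, trace_roots s b1 b2 b3 b4 x1 x2 x3 x4.
Proof.
have [g0 [g1 [g2 [s1 s2 s3 SE]]]] := Sseq_cardano.
pose c := b4 - rfconst s b1 b2 b3.
have [h1 [h2 [h3 [h12 h23 hp]]]] := sorted_triple g0 g1 g2.
have [E1 E2 E3] := perm3_esym hp.
rewrite {}E1 in s1; rewrite {}E2 in s2; rewrite {}E3 in s3.
have [f1 f2 f3] := dquartic_crit c s1 s2 s3.
have -> : cond_f q a1 a2 a3 a4 zeta sD omega <->
    [/\ dquartic u v c h1 <= 0, 0 <= dquartic u v c h2 & dquartic u v c h3 <= 0].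
  (* The quartic is c - [dvalue] at its critical points, and its outer ones are minima on their
     sides of [h2]; so [dvalue] is least at [h2]. *)
  have v21 : dvalue u v h2 <= dvalue u v h1.
    have := dquartic_min_left c s1 s2 s3 h12 h23 (lexx _).
    by rewrite f1 f2 lerD2l lerN2.
  have v23 : dvalue u v h2 <= dvalue u v h3.
    have := dquartic_min_right c s1 s2 s3 h12 h23 (lexx _).
    by rewrite f2 f3 lerD2l lerN2.
  have p3 := perm_map (dvalue u v) hp.
  rewrite f1 f2 f3 !subr_le0 subr_ge0.
  have := @sort3P _ _ _ _ _ _ c p3 v21 v23.
  (* The order on [algC] is only partial, but [algRval] respects it, so the sorting can be done in
     the total order of [algR]. *)
  have TE : thetas q a1 a2 a3 zeta sD omega =
      map algRval (sort <=%O [seq dvalue u v g | g <- [:: g0; g1; g2]]).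
    rewrite /thetas SE map_comp; symmetry; exact: map_sort.
  have szS : size (sort <=%O [seq dvalue u v g | g <- [:: g0; g1; g2]]) = 3%N.
    by rewrite size_sort.
  rewrite /cond_f TE !(nth_map 0) ?szS // fconst_algC.
  rewrite -(rmorph_int algRval a4) -!(rmorphD algRval) -!algR_leE.
  have lo x : (rfconst s b1 b2 b3 + x <= b4) = (x <= c) by rewrite /c lerBrDl.
  have hi x : (b4 <= rfconst s b1 b2 b3 + x) = (c <= x) by rewrite /c lerBlDl.
  by rewrite lo hi => ->; split=> -[].
split.
  move=> [k1 k2 k3].
  have [t1 [t2 [t3 [t4 e]]]] := dquartic_split_real s1 s2 s3 h12 h23 k1 k2 k3.
  exists (t1 - b1 / 4), (t2 - b1 / 4), (t3 - b1 / 4), (t4 - b1 / 4).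
  by apply/trace_roots_depress; rewrite !subrK.
move=> [x1 [x2 [x3 [x4 /trace_roots_depress[e1 e2 e3 e4]]]]].
exact: (dquartic_crit_sign s1 s2 s3 h12 h23 e1 e2 e3 e4).
Qed.

End Thetas.

End Transfer.

(** * Integral factors and irrationality of sqrt q *)

(** Division by a monic polynomial already works over the integers. Over [algC] the remainder is a
    multiple of [d] of smaller degree, hence zero, so the complex cofactor is the integral
    quotient. *)
Lemma mapC_divides (p d : {poly int}) (P : {poly algC}) : d \is monic ->
  mapC p = mapC d * P -> exists2 p0, p = d * p0 & mapC p0 = P.
Proof.
move=> d_monic pE; have dC_monic : mapC d \is monic by exact: monic_map.
have szC (r : {poly int}) : size (mapC r) = size r.
  exact: (size_map_inj_poly (@intr_inj algC)).
pose p0 := Pdiv.CommonRing.rdivp p d; pose r := Pdiv.CommonRing.rmodp p d.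
have pdr : p = p0 * d + r by exact: Pdiv.RingMonic.rdivp_eq.
have rE : mapC r = (P - mapC p0) * mapC d.
  by move: pE; rewrite {1}pdr rmorphD rmorphM /= mulrBl [P * _]mulrC => <-; ring.
have P0 : P - mapC p0 = 0.
  apply/eqP; apply: contraT => Pn.
  have : (size (mapC r) < size (mapC d))%N.
    by rewrite !szC Pdiv.CommonRing.ltn_rmodpN0 // monic_neq0.
  rewrite rE size_Mmonic //; move: Pn; rewrite -size_poly_gt0.
  by case: (size _) => // n _; rewrite addSn /= ltnNge leq_addl.
have r0 : r = 0 by apply/eqP; rewrite -size_poly_eq0 -szC rE P0 mul0r size_poly0.
exists p0; first by rewrite {1}pdr r0 addr0 mulrC.
by apply/eqP; rewrite eq_sym -subr_eq0 P0.
Qed.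

Lemma weil_divides (q g : nat) (p d : {poly int}) (xs : seq algR) :
    (0 < g)%N -> size xs = g ->
    {in xs, forall x, - (2 * rsqrt q) <= x <= 2 * rsqrt q} -> d \is monic ->
    mapC p = mapC d * \prod_(x <- xs) qfactor (rsqrt q) x ->
  exists h0, weil q g h0 /\ p = d * h0.
Proof.
move=> g0 sxs xsB dm /(mapC_divides dm)[p0 -> pE]; exists p0; split=> //.
by apply/weilP; split=> //; exists xs.
Qed.

Lemma qfactor_pos (s : algR) : qfactor s (2 * s) = ('X - (algRval s)%:P) ^+ 2.
Proof.
by rewrite /qfactor !algRvalE polyCM rmorphXn /= polyC_natr; ring.
Qed.

Lemma qfactor_neg (s : algR) : qfactor s (- (2 * s)) = ('X + (algRval s)%:P) ^+ 2.
Proof.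
by rewrite /qfactor !algRvalE polyCN polyCM rmorphXn /= polyC_natr; ring.
Qed.

Lemma rsqrt_sqr (r : nat) : algRval (rsqrt (r ^ 2)) = r%:R.
Proof. by rewrite /= natrX sqrCK. Qed.

Lemma rsqrt_natP (q : nat) :
  reflect (is_square q) (sqrtC (q%:R : algC) \is a Num.nat).
Proof.
apply: (iffP natrP) => [[r rE]|[r ->]]; last first.
  by exists r; rewrite natrX sqrCK ?ler0n.
exists r; apply/eqP; rewrite -(eqr_nat algC) natrX -rE.
by rewrite sqrtCK.
Qed.

(** If B were nonzero, sqrt q = -A/B would be rational; as a root of the monic X^2 - q it is an
    algebraic integer, so it would be an integer and q a square. *)
Lemma rsqrt_irrational (q : nat) (A B : int) : ~ is_square q ->
  A%:~R + rsqrt q * B%:~R = 0 -> A = 0 /\ B = 0.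
Proof.
move=> nsq AB; have [B0|B0] := eqVneq B 0.
  split=> //; move: AB; rewrite B0 mulr0 addr0.
  by move/eqP; rewrite intr_eq0 => /eqP.
case: nsq; apply/rsqrt_natP; rewrite natrEint sqrtC_ge0 ler0n andbT.
apply: Cint_rat_Aint.
  have -> : sqrtC (q%:R : algC) = - (A%:~R / B%:~R).
    have BC : (B%:~R : algC) != 0 by rewrite intr_eq0.
    apply: (mulIf BC); rewrite mulNr divfK //; apply/eqP.
    rewrite -addr_eq0 addrC; apply/eqP.
    by have := congr1 algRval AB; rewrite !algRvalE.
  by rewrite rpredN rpred_div // rpred_int.
apply: (@root_monic_Aint ('X^2 - (q%:R)%:P)).
- by rewrite /root !hornerE sqrtCK subrr.
- by rewrite monicXnsubC.
- by rewrite polyOverXnsubC rpred_nat.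
Qed.

(** The products of the gaps 2s - x_i and 2s + x_i are A + sB and A - sB with integers A and B. For
    irrational s, if one vanishes then A = B = 0 and so does the other. *)
Lemma irrational_bounds (q : nat) (a1 a2 a3 a4 : int) (x1 x2 x3 x4 : algR)
    (s := rsqrt q) (xs := [:: x1; x2; x3; x4]) :
    ~ is_square q ->
    trace_roots s a1%:~R a2%:~R a3%:~R a4%:~R x1 x2 x3 x4 ->
    2 * s \in xs \/ - (2 * s) \in xs -> 2 * s \in xs /\ - (2 * s) \in xs.
Proof.
move=> nsq tr; have [_ _ _ P] := trace_roots_gap tr.
have [_ _ _ N] := trace_roots_gap (trace_roots_opp tr).
pose A : int := a4 + 2 * q%:Z * a2 + 2 * q%:Z ^+ 2.
pose B : int := 2 * (q%:Z * a1 + a3).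
have AE : A%:~R = (a4%:~R : algR) + 2 * s ^+ 2 * a2%:~R + 2 * (s ^+ 2) ^+ 2.
  by rewrite rsqrtK /A !(rmorphD, rmorphM, rmorphXn).
have BE : s * B%:~R = 2 * s * (s ^+ 2 * a1%:~R + a3%:~R).
  by rewrite rsqrtK /B !(rmorphD, rmorphM) /=; ring.
rewrite -AE -BE in P.
have {}N : (2 * s - - x1) * (2 * s - - x2) * (2 * s - - x3) * (2 * s - - x4)
    = A%:~R - s * B%:~R by rewrite N AE BE; ring.
have posE : (2 * s \in xs) = (A%:~R + s * B%:~R == 0).
  by rewrite -P !mulf_eq0 !subr_eq0 !inE !orbA.
have negE : (- (2 * s) \in xs) = (A%:~R - s * B%:~R == 0).
  by rewrite -N !mulf_eq0 !opprK !addr_eq0 !inE !eqr_oppLR !orbA.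
rewrite posE negE => h; have [-> ->] : A = 0 /\ B = 0.
  case: h => /eqP h; first exact: (rsqrt_irrational nsq h).
  have /(rsqrt_irrational nsq)[-> /eqP] : A%:~R + s * (- B)%:~R = 0.
    by rewrite rmorphN mulrN.
  by rewrite oppr_eq0 => /eqP.
by rewrite mulr0 addr0 subr0 eqxx.
Qed.

Lemma mapC_linear_sqr (r : int) :
  mapC (('X - r%:P) ^+ 2) = ('X - (algRval r%:~R)%:P) ^+ 2.
Proof.
by rewrite rmorphXn rmorphB /= map_polyX map_polyC /= (rmorph_int algRval).
Qed.

Lemma mapC_quadratic_sqr (q : nat) (s := rsqrt q) :
  mapC (('X ^+ 2 - (q%:Z)%:P) ^+ 2) = qfactor s (2 * s) * qfactor s (- (2 * s)).
Proof.
rewrite qfactor_pos qfactor_neg rmorphXn rmorphB rmorphXn /= map_polyX map_polyC.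
have -> : (q%:~R : algC)%:P = (algRval s)%:P ^+ 2.
  by rewrite -rmorphXn /= sqrtCK.
by rewrite -exprMn; congr (_ ^+ 2); rewrite -subr_sqr.
Qed.

(** Letting the integer [r] be negative covers the factors X - sqrt q and X + sqrt q at once. *)
Lemma weil_square_factor (q : nat) (p : {poly int}) (r : int) (xs : seq algR)
    (x : algR) :
    size xs = 4%N -> {in xs, forall x, - (2 * rsqrt q) <= x <= 2 * rsqrt q} ->
    mapC p = \prod_(x <- xs) qfactor (rsqrt q) x -> x \in xs ->
    x = 2 * r%:~R -> (r%:~R == rsqrt q) || (r%:~R == - rsqrt q) ->
  exists h0, weil q 3 h0 /\ p = ('X - r%:P) ^+ 2 * h0.
Proof.
move=> sxs xsB pE xxs xE rE.
apply: (@weil_divides _ _ _ _ (rem x xs)) => //.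
- by rewrite size_rem // sxs.
- by move=> y /mem_rem; exact: xsB.
- by rewrite monic_exp // monicXsubC.
rewrite pE (perm_big _ (perm_to_rem xxs)) big_cons; congr (_ * _).
rewrite mapC_linear_sqr xE; case/orP: rE => /eqP ->; first by rewrite qfactor_pos.
by rewrite mulrN qfactor_neg (rmorphN algRval) polyCN opprK.
Qed.

Lemma weil_irrational_factor (q : nat) (p : {poly int}) (xs : seq algR)
    (s := rsqrt q) :
    (0 < q)%N -> size xs = 4%N -> {in xs, forall x, - (2 * s) <= x <= 2 * s} ->
    mapC p = \prod_(x <- xs) qfactor s x ->
    2 * s \in xs -> - (2 * s) \in xs ->
  exists h0, weil q 2 h0 /\ p = ('X ^+ 2 - (q%:Z)%:P) ^+ 2 * h0.
Proof.
move=> q0 sxs xsB pE sx nsx.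
have s_gt0 : 0 < s.
  by rewrite lt_neqAle rsqrt_ge0 andbT eq_sym -sqrf_eq0 rsqrtK pnatr_eq0 -lt0n.
(* Positivity of s makes 2s and -2s distinct, so they are two different entries of the list and both
   factors can be removed. *)
have nsx' : - (2 * s) \in rem (2 * s) xs.
  have := nsx; rewrite (perm_mem (perm_to_rem sx)) inE => /orP[/eqP|//].
  by move=> E; exfalso; move: s_gt0 E; lra.
apply: (@weil_divides _ _ _ _ (rem (- (2 * s)) (rem (2 * s) xs))) => //.
- by rewrite !size_rem // sxs.
- by move=> y /mem_rem/mem_rem; exact: xsB.
- by rewrite monic_exp // monicXnsubC.
rewrite pE (perm_big _ (perm_to_rem sx)) big_cons.
rewrite (perm_big _ (perm_to_rem nsx')) big_cons /= mulrA; congr (_ * _).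
by rewrite mapC_quadratic_sqr.
Qed.

Theorem theoremB (p q : nat) (a1 a2 a3 a4 : int)
  (hp : prime p) (hq : exists n : nat, (0 < n)%N /\ q = (p ^ n)%N)
  (zeta sD omega : algC)
  (hzeta : 3.-primitive_root zeta)
  (hsD : sD ^+ 2 = Delta q a1 a2 a3)
  (homega : omega ^+ 3 = (- u3 q a1 a2 a3 + sD) / 2) :
  let h := hpoly q a1 a2 a3 a4 in
  ((weil q 4 h \/
     (cond_a q a1 /\ cond_bs q a1 a2 /\ cond_b q a1 a2 /\ cond_c q a1 a2 a3
      /\ cond_d q a1 a2 a3)) ->
     forall s, s \in Sseq q a1 a2 a3 zeta sD omega -> s \is Num.real)
  /\
  (weil q 4 h <->
     cond_a q a1 /\ cond_bs q a1 a2 /\ cond_b q a1 a2 /\ cond_c q a1 a2 a3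
     /\ cond_d q a1 a2 a3 /\ cond_e q a1 a2 a3 a4
     /\ cond_f q a1 a2 a3 a4 zeta sD omega)
  /\
  (weil q 4 h ->
     (has_real_root h <->
        `|(a1%:~R : algC)| = 8 * sqrtC q%:R
        \/ 6 * sqrtC q%:R * `|(a1%:~R : algC)| - 20 * q%:R = a2%:~R
        \/ - 9 * q%:R * a1%:~R - 4 * sqrtC q%:R * a2%:~R
             - 16 * q%:R * sqrtC q%:R = (a3%:~R : algC)
        \/ (a3%:~R : algC) = - 9 * q%:R * a1%:~R + 4 * sqrtC q%:R * a2%:~R
             + 16 * q%:R * sqrtC q%:R
        \/ 2 * sqrtC q%:R * `|q%:R * a1%:~R + a3%:~R| - 2 * q%:R * a2%:~R
             - 2 * (q%:R : algC) ^+ 2 = a4%:~R))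
  /\
  (let caseI := exists r : nat, q = (r ^ 2)%N /\
        exists h0 : {poly int}, weil q 3 h0 /\
          (h = ('X + (r%:Z)%:P) ^+ 2 * h0 \/ h = ('X - (r%:Z)%:P) ^+ 2 * h0) in
   let caseII := ~ is_square q /\
        exists h0 : {poly int}, weil q 2 h0 /\
          h = ('X ^+ 2 - (q%:Z)%:P) ^+ 2 * h0 in
   ((weil q 4 h /\ has_real_root h) <-> (caseI \/ caseII)) /\ ~ (caseI /\ caseII)).
Proof.
move=> h; set s := rsqrt q.
have q_gt0 : (0 < q)%N by case: hq => n [_ ->]; rewrite expn_gt0 prime_gt0.
have weil_disc : weil q 4 h -> ru3 s a1%:~R a2%:~R a3%:~R ^+ 2
    + 4 * ru2 s a1%:~R a2%:~R ^+ 3 / 27 <= 0.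
  by move=> /weil4P[x1 [x2 [x3 [x4 [_ /trace_roots_disc]]]]].
split.
  move=> H t; have d0 : ru3 s a1%:~R a2%:~R a3%:~R ^+ 2
      + 4 * ru2 s a1%:~R a2%:~R ^+ 3 / 27 <= 0.
    case: H => [/weil_disc//|[_ [_ [cb [_ cd]]]]].
    by apply/cond_bd_algC; split.
  have [g0 [g1 [g2 [_ _ _ ->]]]] := Sseq_cardano hzeta hsD homega d0.
  by move=> /mapP[g _ ->]; exact: algRvalP.
split.
  split.
    move=> W; have d0 := weil_disc W.
    have [x1 [x2 [x3 [x4 [xsB tr]]]]] := (weil4P _ _ _ _ _).1 W.
    have [ca cbs cc ce] : [/\ cond_a q a1, cond_bs q a1 a2, cond_c q a1 a2 a3
        & cond_e q a1 a2 a3 a4].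
      by apply/bound_conds_algC/(bound_condsP (rsqrt_ge0 q) tr).
    have [cb cd] := (cond_bd_algC _ _ _ _).2 d0.
    do 6 split=> //; apply/(cond_f_algC _ hzeta hsD homega d0).
    by exists x1, x2, x3, x4.
  move=> [ca [cbs [cb [cc [cd [ce cf]]]]]].
  have d0 := (cond_bd_algC _ _ _ _).1 (conj cb cd).
  have [x1 [x2 [x3 [x4 tr]]]] := (cond_f_algC _ hzeta hsD homega d0).1 cf.
  apply/weil4P; exists x1, x2, x3, x4; split=> //.
  apply/(bound_condsP (rsqrt_ge0 q) tr)/bound_conds_algC.
  by split.
split.
  move=> /weil4P[x1 [x2 [x3 [x4 [xsB tr]]]]].
  rewrite -bound_equalities_algC -(bound_equalitiesP (rsqrt_ge0 q) tr xsB).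
  apply: has_real_rootP => //; exact: trace_roots_hpoly.
split; last first.
  by move=> [[r [qr _]] [nsq _]]; apply: nsq; exists r.
split.
  move=> [/weil4P[x1 [x2 [x3 [x4 [xsB tr]]]]] hr].
  have pE := trace_roots_hpoly tr.
  have size4 : size [:: x1; x2; x3; x4] = 4%N by [].
  have [x xxs x2s] := (has_real_rootP xsB pE).1 hr.
  have {}x2s : x = 2 * s \/ x = - (2 * s).
    by move/eqP: x2s; rewrite eqf_sqr => /orP[/eqP|/eqP]; [left|right].
  have [/rsqrt_natP sq|/rsqrt_natP nsq] :=
    boolP (sqrtC (q%:R : algC) \is a Num.nat).
    left; case: sq => r qr; exists r; split=> //.
    have sr : s = r%:~R.
      by apply: algRval_inj; rewrite /s qr rsqrt_sqr rmorph_int.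
    case: x2s => xE.
      have rx : x = 2 * r%:~R by rewrite xE sr.
      have rs : (r%:~R == s) || (r%:~R == - s) by rewrite sr eqxx.
      have [h0 [W hE]] := weil_square_factor size4 xsB pE xxs rx rs.
      by exists h0; split=> //; right.
    have rx : x = 2 * (- r%:Z)%:~R by rewrite xE sr rmorphN mulrN.
    have rs : ((- r%:Z)%:~R == s) || ((- r%:Z)%:~R == - s).
      by rewrite sr rmorphN eqxx orbT.
    have [h0 [W hE]] := weil_square_factor size4 xsB pE xxs rx rs.
    by exists h0; split=> //; left; rewrite /h hE polyCN opprK.
  right; split=> //.
  have [sx nsx] : 2 * s \in [:: x1; x2; x3; x4]
      /\ - (2 * s) \in [:: x1; x2; x3; x4].
    by apply: (irrational_bounds nsq tr); case: x2s => <-; [left|right].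
  exact: (weil_irrational_factor q_gt0 size4 xsB pE sx nsx).
have ends_bound x : x \in [:: 2 * s; - (2 * s)] -> - (2 * s) <= x <= 2 * s.
  have := rsqrt_ge0 q; rewrite -/s !inE => s0 /orP[] /eqP ->;
    by apply/andP; split; lra.
have ends_sqr x : x \in [:: 2 * s; - (2 * s)] -> x ^+ 2 = (2 * s) ^+ 2.
  by rewrite !inE => /orP[] /eqP ->; rewrite ?sqrrN.
(* For the converse, [es] holds the extreme traces contributed by the explicit factor of h and [xs]
   the traces of [h0]; any entry of [es] provides the real root. *)
have extend (es xs : seq algR) :
    {subset es <= [:: 2 * s; - (2 * s)]} -> es != [::] ->
    (size es + size xs = 4)%N -> {in xs, forall x, - (2 * s) <= x <= 2 * s} ->
    mapC h = \prod_(x <- es ++ xs) qfactor s x -> weil q 4 h /\ has_real_root h.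
  move=> esE es0 sz xsB hE.
  have B : {in es ++ xs, forall x, - (2 * s) <= x <= 2 * s}.
    by move=> x; rewrite mem_cat => /orP[/esE/ends_bound|/xsB].
  split; first by apply/weilP; split=> //; exists (es ++ xs); rewrite size_cat.
  apply/(has_real_rootP B hE).
  case: es esE es0 {sz hE B} => // e es esE _; exists e; first exact: mem_head.
  by apply: ends_sqr; apply: esE; exact: mem_head.
case=> [[r [qr [h0 [/weilP[_ [xs [sxs xsB h0E]]] hE]]]]|].
  have sr : algRval s = algRval r%:~R by rewrite /s qr rsqrt_sqr rmorph_int.
  case: hE => hE.
    apply: (extend [:: - (2 * s)] xs) => //; last 2 first.
    - by rewrite /= sxs.
    - rewrite hE rmorphM /= h0E big_cons; congr (_ * _).
      by rewrite -[r%:Z]opprK polyCN mapC_linear_sqr qfactor_neg sr !rmorphN opprK.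
    by move=> x; rewrite !inE => ->; rewrite orbT.
  apply: (extend [:: 2 * s] xs) => //; last 2 first.
  - by rewrite /= sxs.
  - rewrite hE rmorphM /= h0E big_cons; congr (_ * _).
    by rewrite mapC_linear_sqr qfactor_pos sr.
  by move=> x; rewrite !inE => ->.
move=> [_ [h0 [/weilP[_ [xs [sxs xsB h0E]]] hE]]].
apply: (extend [:: 2 * s; - (2 * s)] xs) => //; first by rewrite /= sxs.
by rewrite hE rmorphM /= mapC_quadratic_sqr h0E !big_cons mulrA.
Qed.
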